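(* $\widetilde B$ is a prime ring.
   Context: Let $k$ be an algebraically closed field of characteristic not $2$, and let $\alpha_1,\alpha_2,\alpha_3\in k$ satisfy $\alpha_1+\alpha_2+\alpha_3+\alpha_1\alpha_2\alpha_3=0$ and $\{\alpha_1,\alpha_2,\alpha_3\}\cap\{0,1,-1\}=\varnothing$. Let $Q$ be the quotient of the free algebra $k\langle x_0,x_1,x_2,x_3\rangle$ (graded, $\deg x_j=1$) by the six relations $x_0x_i-x_ix_0=\alpha_i(x_jx_k+x_kx_j)$, $x_0x_i+x_ix_0=x_jx_k-x_kx_j$, $(i,j,k)$ running over the cyclic permutations of $(1,2,3)$. The elements $\Omega=-x_0^2+x_1^2+x_2^2+x_3^2$ and $\Omega'=x_1^2+\frac{1+\alpha_1}{1-\alpha_2}x_2^2+\frac{1-\alpha_1}{1+\alpha_3}x_3^2$ of $Q$ are central; $B=Q/(\Omega,\Omega')$, which is isomorphic to a twisted homogeneous coordinate ring of an elliptic curve. The group $\Gamma=\{1,\gamma_1,\gamma_2,\gamma_3=\gamma_1\gamma_2\}\cong\mathbb Z/2\times\mathbb Z/2$ acts on $Q$ and $B$ by: $\gamma_i$ fixes $x_0,x_i$ and negates $x_j$ for $j\in\{1,2,3\}\setminus\{i\}$. It acts on $M_2(k)$ by $\gamma_j(a)=q_jaq_j^{-1}$ where, with $i^2=-1$, $q_1=\begin{pmatrix}i&0\\0&-i\end{pmatrix}$, $q_2=\begin{pmatrix}0&i\\i&0\end{pmatrix}$, $q_3=\begin{pmatrix}0&-1\\1&0\end{pmatrix}$.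 Put $\widetilde B=(B\otimes M_2(k))^\Gamma$ (diagonal action). *)

(* Defs.v *)
From HB Require Import structures.
From mathcomp Require Import all_boot all_algebra.
From mathcomp Require Import boolp.
From mathcomp Require Import finmap monalg.

Set Implicit Arguments.
Unset Strict Implicit.
Unset Printing Implicit Defensive.

Import GRing.Theory.

Local Open Scope ring_scope.

(* The zero ideal is a prime ideal; two-sided ideals are arbitrary predicates. *)
Definition two_sided_ideal (R : nzRingType) (I : R -> Prop) : Prop :=
  [/\ I 0, forall x y, I x -> I y -> I (x + y)
    & forall a x b, I x -> I (a * x * b)].

Definition prime_ring (R : nzRingType) : Prop :=
  forall I J : R -> Prop, two_sided_ideal I -> two_sided_ideal J ->
    (forall x y, I x -> J y -> x * y = 0) ->
    (forall x, I x -> x = 0) \/ (forall y, J y -> y = 0).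

Section TwoSidedQuotient.
Variables (k : fieldType) (A : algType k).

Definition tsideal (S : seq A) : {pred A} := fun a =>
  `[< exists2 l : seq (A * A * A), all (fun t => t.1.2 \in S) l
        & a = \sum_(t <- l) t.1.1 * t.1.2 * t.2 >].

Variable S : seq A.

Lemma tsidealP a : reflect
  (exists2 l : seq (A * A * A), all (fun t => t.1.2 \in S) l
     & a = \sum_(t <- l) t.1.1 * t.1.2 * t.2)
  (a \in tsideal S).
Proof. exact: asboolP. Qed.

Lemma tsideal_gen s : s \in S -> s \in tsideal S.
Proof.
move=> Ss; apply/tsidealP; exists [:: (1, s, 1)]; first by rewrite /= Ss.
by rewrite big_seq1 /= mul1r mulr1.
Qed.

Lemma tsidealMM u v a : a \in tsideal S -> u * a * v \in tsideal S.
Proof.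
case/tsidealP => l Sl ->; apply/tsidealP.
exists [seq (u * t.1.1, t.1.2, t.2 * v) | t <- l]; first by rewrite all_map.
rewrite big_map mulr_sumr mulr_suml.
by apply: eq_bigr => t _ /=; rewrite !mulrA.
Qed.

Lemma tsidealMl u a : a \in tsideal S -> u * a \in tsideal S.
Proof. by move/(tsidealMM u 1); rewrite mulr1. Qed.

Lemma tsidealMr v a : a \in tsideal S -> a * v \in tsideal S.
Proof. by move/(tsidealMM 1 v); rewrite mul1r. Qed.

Lemma tsidealZ c a : a \in tsideal S -> c *: a \in tsideal S.
Proof. by move/(tsidealMl (c%:A)); rewrite mulr_algl. Qed.

Lemma tsideal_zmod_closed : zmod_closed (tsideal S).
Proof.
split=> [|a b]; first by apply/tsidealP; exists [::]; rewrite ?big_nil.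
move=> /tsidealP[l Sl ->] /(tsidealMl (-1)) /tsidealP[m Sm Em].
apply/tsidealP; exists (l ++ m); first by rewrite all_cat Sl Sm.
by rewrite big_cat /= -Em mulN1r.
Qed.

HB.instance Definition _ :=
  GRing.isZmodClosed.Build A (tsideal S) tsideal_zmod_closed.

Lemma rmorph_tsideal (C : nzRingType) (f : {rmorphism A -> C}) :
  (forall s, s \in S -> f s = 0) -> forall a, a \in tsideal S -> f a = 0.
Proof.
move=> fS a /tsidealP[l Sl ->]; rewrite rmorph_sum /= big_seq big1 // => t lt.
by rewrite !rmorphM /= (fS _ (allP Sl _ lt)) mulr0 mul0r.
Qed.

Lemma tsideal_proper (C : nzRingType) (f : {rmorphism A -> C}) :
  (forall s, s \in S -> f s = 0) -> 1 \notin tsideal S.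
Proof.
move=> fS; apply/negP => /(rmorph_tsideal fS)/eqP.
by rewrite rmorph1 oner_eq0.
Qed.

(* The quotient A / (S); the ideal must be proper because algebras are *)
(* nontrivial in the algebraic hierarchy.                              *)
Definition quoalg (h : 1 \notin tsideal S) : Type :=
  Quotient.quot (tsideal S).

Variable h : 1 \notin tsideal S.
Local Notation Q := (quoalg h).

HB.instance Definition _ := GRing.Zmodule.on Q.

Definition qproj (a : A) : Q := \pi_(Quotient.quot (tsideal S))%qT a.
Definition qrepr (x : Q) : A := repr (x : Quotient.quot (tsideal S)).

Lemma qreprK x : qproj (qrepr x) = x.
Proof. exact: reprK. Qed.

Fact qproj_is_zmod_morphism : zmod_morphism qproj.
Proof. exact: (raddfB (\pi_(Quotient.quot (tsideal S)))%qT). Qed.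
HB.instance Definition _ :=
  GRing.isZmodMorphism.Build A Q qproj qproj_is_zmod_morphism.

Lemma qproj_eq a b : (qproj a == qproj b) = (a - b \in tsideal S).
Proof. by rewrite /qproj [in RHS]Quotient.idealrBE. Qed.

Lemma qproj_eq0 a : (qproj a == 0) = (a \in tsideal S).
Proof. by rewrite -(raddf0 qproj) qproj_eq subr0. Qed.

Lemma qprojK a : qrepr (qproj a) - a \in tsideal S.
Proof. by rewrite -qproj_eq qreprK. Qed.

Definition qone : Q := qproj 1.
Definition qmul (x y : Q) : Q := qproj (qrepr x * qrepr y).
Definition qscale (c : k) (x : Q) : Q := qproj (c *: qrepr x).

Fact qprojM a b : qproj (a * b) = qmul (qproj a) (qproj b).
Proof.
apply/esym/eqP; rewrite /qmul qproj_eq.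
rewrite -[_ * qrepr _](subrK (a * qrepr (qproj b))) -mulrBl -addrA -mulrBr.
exact: rpredD (tsidealMr _ (qprojK a)) (tsidealMl _ (qprojK b)).
Qed.

Fact qprojZ c a : qproj (c *: a) = qscale c (qproj a).
Proof.
by apply/esym/eqP; rewrite /qscale qproj_eq -scalerBr tsidealZ ?qprojK.
Qed.

Fact qmulA : associative qmul.
Proof.
move=> x y z; rewrite -(qreprK x) -(qreprK y) -(qreprK z).
by rewrite -!qprojM mulrA.
Qed.
Fact qmul1 : left_id qone qmul.
Proof. by move=> x; rewrite -(qreprK x) -qprojM mul1r. Qed.
Fact qmulr1 : right_id qone qmul.
Proof. by move=> x; rewrite -(qreprK x) -qprojM mulr1. Qed.
Fact qmulDl : left_distributive qmul +%R.
Proof.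
move=> x y z; rewrite -(qreprK x) -(qreprK y) -(qreprK z).
by rewrite -raddfD -!qprojM -raddfD mulrDl.
Qed.
Fact qmulDr : right_distributive qmul +%R.
Proof.
move=> x y z; rewrite -(qreprK x) -(qreprK y) -(qreprK z).
by rewrite -raddfD -!qprojM -raddfD mulrDr.
Qed.
Fact qone_neq0 : qone != 0.
Proof. by rewrite qproj_eq0. Qed.

HB.instance Definition _ := GRing.Zmodule_isNzRing.Build Q
  qmulA qmul1 qmulr1 qmulDl qmulDr qone_neq0.

Fact qscaleA c d x : qscale c (qscale d x) = qscale (c * d) x.
Proof. by rewrite -(qreprK x) -!qprojZ scalerA. Qed.
Fact qscale1 : left_id 1 qscale.
Proof. by move=> x; rewrite -(qreprK x) -qprojZ scale1r. Qed.
Fact qscaleDr : right_distributive qscale +%R.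
Proof.
move=> c x y; rewrite -(qreprK x) -(qreprK y).
by rewrite -raddfD -!qprojZ -raddfD scalerDr.
Qed.
Fact qscaleDl x : {morph qscale^~ x : c d / c + d}.
Proof. by move=> c d; rewrite -(qreprK x) -!qprojZ -raddfD scalerDl. Qed.

HB.instance Definition _ := GRing.Zmodule_isLmodule.Build k Q
  qscaleA qscale1 qscaleDr qscaleDl.

Fact qscaleAl (c : k) (x y : Q) : c *: (x * y) = (c *: x) * y.
Proof.
rewrite -(qreprK x) -(qreprK y) -[RHS]/(qmul (qscale c _) _).
by rewrite -[LHS]/(qscale c (qmul _ _)) -qprojM -!qprojZ -qprojM scalerAl.
Qed.
HB.instance Definition _ := GRing.Lmodule_isLalgebra.Build k Q qscaleAl.

Fact qscaleAr (c : k) (x y : Q) : c *: (x * y) = x * (c *: y).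
Proof.
rewrite -(qreprK x) -(qreprK y) -[RHS]/(qmul _ (qscale c _)).
by rewrite -[LHS]/(qscale c (qmul _ _)) -qprojM -!qprojZ -qprojM scalerAr.
Qed.
HB.instance Definition _ := GRing.Lalgebra_isAlgebra.Build k Q qscaleAr.

Fact qproj_is_monoid_morphism : monoid_morphism qproj.
Proof. by split=> // a b; rewrite qprojM. Qed.
HB.instance Definition _ :=
  GRing.isMonoidMorphism.Build A Q qproj qproj_is_monoid_morphism.

Fact qproj_is_scalable : scalable qproj.
Proof. exact: qprojZ. Qed.
HB.instance Definition _ :=
  GRing.isScalable.Build k A Q *:%R qproj qproj_is_scalable.

Section Lift.
Variables (C : algType k) (f : {lrmorphism A -> C}).
Hypothesis fS : forall s, s \in S -> f s = 0.

Definition qlift of (forall s, s \in S -> f s = 0) : Q -> C :=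
  fun x => f (qrepr x).

Lemma qliftE a : qlift fS (qproj a) = f a.
Proof.
apply: subr0_eq; rewrite /qlift -rmorphB.
exact: rmorph_tsideal fS _ (qprojK a).
Qed.

Fact qlift_is_zmod_morphism : zmod_morphism (qlift fS).
Proof.
move=> x y; rewrite -(qreprK x) -(qreprK y).
by rewrite -raddfB !qliftE raddfB.
Qed.
HB.instance Definition _ :=
  GRing.isZmodMorphism.Build Q C (qlift fS) qlift_is_zmod_morphism.

Fact qlift_is_monoid_morphism : monoid_morphism (qlift fS).
Proof.
split=> [|x y]; first by rewrite -(rmorph1 qproj) qliftE rmorph1.
rewrite -(qreprK x) -(qreprK y).
by rewrite -rmorphM !qliftE rmorphM.
Qed.
HB.instance Definition _ :=
  GRing.isMonoidMorphism.Build Q C (qlift fS) qlift_is_monoid_morphism.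

Fact qlift_is_scalable : scalable (qlift fS).
Proof. by move=> c x; rewrite -(qreprK x) -linearZ !qliftE linearZ. Qed.
HB.instance Definition _ :=
  GRing.isScalable.Build k Q C *:%R (qlift fS) qlift_is_scalable.

End Lift.

End TwoSidedQuotient.

Arguments qlift {k A S} h {C f} fS x.

Fact malg_scaleAr (K : monomType) (R : comNzRingType) (c : R)
    (x y : {malg R[K]}) : c *: (x * y) = x * (c *: y).
Proof.
apply/malgP => m; rewrite mcoeffZ mcoeffMl.
rewrite (mcoeffMlw _ (fsubset_refl _) (msuppZ_le c y)) mulr_sumr.
apply: eq_bigr => i _; rewrite mulr_sumr; apply: eq_bigr => j _.
by rewrite mcoeffZ mulrnAr mulrCA.
Qed.

(* The free algebra on x_0, ..., x_(n-1), as the algebra of the free monoid. *)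
Definition freealg (k : fieldType) (n : nat) : Type :=
  {malg k[{fmonom 'I_n}]}.

Section FreeAlgebra.
Variables (k : fieldType) (n : nat).
Local Notation F := (freealg k n).

HB.instance Definition _ := GRing.Lalgebra.on F.

Fact freealg_scaleAr (c : k) (x y : F) : c *: (x * y) = x * (c *: y).
Proof. exact: malg_scaleAr. Qed.
HB.instance Definition _ := GRing.Lalgebra_isAlgebra.Build k F freealg_scaleAr.

Definition fgen (j : 'I_n) : F := << fmu j >>.

Section Subst.
Variables (A : algType k) (v : 'I_n -> A).

Definition word_eval (m : {fmonom 'I_n}) : A := \prod_(j <- (m : seq 'I_n)) v j.

Fact word_eval_is_mmorphism : mmorphism word_eval.
Proof.
split=> [m1 m2|]; last by rewrite /word_eval fm1 big_nil.
by rewrite /word_eval fmM big_cat.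
Qed.
HB.instance Definition _ :=
  monalg.isMultiplicative.Build {fmonom 'I_n} A word_eval
    word_eval_is_mmorphism.

(* The algebra morphism sending x_j to v j *)
Definition fsubst : F -> A := mmap (in_alg A) word_eval.

Fact fsubst_is_zmod_morphism : zmod_morphism fsubst.
Proof. exact: mmap_is_additive. Qed.
HB.instance Definition _ :=
  GRing.isZmodMorphism.Build F A fsubst fsubst_is_zmod_morphism.

Fact fsubst_is_monoid_morphism : monoid_morphism fsubst.
Proof.
have [fM f1] : multiplicative fsubst.
  by apply: commr_mmap_is_multiplicative => g m m'; rewrite /GRing.comm /=
     mulr_algl mulr_algr.
by split.
Qed.
HB.instance Definition _ :=
  GRing.isMonoidMorphism.Build F A fsubst fsubst_is_monoid_morphism.

Fact fsubst_is_scalable : scalable fsubst.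
Proof. by move=> c x; rewrite /fsubst mmapZ /= mulr_algl. Qed.
HB.instance Definition _ :=
  GRing.isScalable.Build k F A *:%R fsubst fsubst_is_scalable.

Lemma fsubst_gen j : fsubst (fgen j) = v j.
Proof. by rewrite /fsubst mmapU /= scale1r mul1r /word_eval fmU big_seq1. Qed.

End Subst.

Lemma fgen_word (c : k) (m : {fmonom 'I_n}) :
  << c *g m >> = c *: word_eval fgen m :> F.
Proof.
have -> : << c *g m >> = c *: (<< m >> : F) :> F.
  by apply/malgP => w; rewrite mcoeffZ !mcoeffU mulrnAr mulr1.
congr (_ *: _); case: m => s; rewrite /word_eval /=.
elim: s => [|j s IHs]; first by rewrite big_nil -[FMonom [::]]fmoneE.
rewrite big_cons -IHs.
have -> : FMonom (j :: s) = mmul (fmu j) (FMonom s).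
  by apply/eqP; rewrite fmP fmM fmU.
by rewrite /fgen [RHS]fgmulUU mulr1.
Qed.

Lemma fsubst_uniq (A : algType k) (f : {lrmorphism F -> A}) :
  f =1 fsubst (f \o fgen).
Proof.
move=> x; rewrite (monalgE x) !linear_sum; apply: eq_bigr => m _.
by rewrite fgen_word !linearZ; congr (_ *: _);
   rewrite !rmorph_prod; apply: eq_bigr => j _; rewrite /= fsubst_gen.
Qed.

End FreeAlgebra.

Definition o0 : 'I_4 := @Ordinal 4 0 isT.
Definition o1 : 'I_4 := @Ordinal 4 1 isT.
Definition o2 : 'I_4 := @Ordinal 4 2 isT.
Definition o3 : 'I_4 := @Ordinal 4 3 isT.

Section Relators.
Variables (k : fieldType) (A : algType k) (x : 'I_4 -> A).

Definition rel_comm (a : k) (i j l : 'I_4) : A :=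
  x o0 * x i - x i * x o0 - a *: (x j * x l + x l * x j).

Definition rel_anti (i j l : 'I_4) : A :=
  x o0 * x i + x i * x o0 - (x j * x l - x l * x j).

Definition sklyanin_rels (a1 a2 a3 : k) : seq A :=
  [:: rel_comm a1 o1 o2 o3; rel_comm a2 o2 o3 o1; rel_comm a3 o3 o1 o2;
      rel_anti o1 o2 o3; rel_anti o2 o3 o1; rel_anti o3 o1 o2].

Definition omega : A := - x o0 ^+ 2 + x o1 ^+ 2 + x o2 ^+ 2 + x o3 ^+ 2.

Definition omega' (a1 a2 a3 : k) : A :=
  x o1 ^+ 2 + ((1 + a1) / (1 - a2)) *: x o2 ^+ 2
  + ((1 - a1) / (1 + a3)) *: x o3 ^+ 2.

End Relators.

Lemma sklyanin_rels_morph (k : fieldType) (A C : algType k)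
    (f : {lrmorphism A -> C}) (x : 'I_4 -> A) (a1 a2 a3 : k) :
  map f (sklyanin_rels x a1 a2 a3) = sklyanin_rels (f \o x) a1 a2 a3.
Proof.
rewrite /sklyanin_rels /rel_comm /rel_anti /=.
by rewrite !(linearB, linearD, linearZ, rmorphM).
Qed.

Lemma omega_morph (k : fieldType) (A C : algType k)
    (f : {lrmorphism A -> C}) (x : 'I_4 -> A) :
  f (omega x) = omega (f \o x).
Proof. by rewrite /omega !(linearD, linearN) !rmorphXn. Qed.

Lemma omega'_morph (k : fieldType) (A C : algType k)
    (f : {lrmorphism A -> C}) (x : 'I_4 -> A) (a1 a2 a3 : k) :
  f (omega' x a1 a2 a3) = omega' (f \o x) a1 a2 a3.
Proof. by rewrite /omega' !(linearD, linearZ) !rmorphXn. Qed.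

Lemma relators0 (k : fieldType) (A : algType k) (a1 a2 a3 : k) :
  [/\ forall s, s \in sklyanin_rels (fun=> 0 : A) a1 a2 a3 -> s = 0,
      omega (fun=> 0 : A) = 0 & omega' (fun=> 0 : A) a1 a2 a3 = 0].
Proof.
have z i j l a : rel_comm (fun=> 0 : A) a i j l = 0.
  by rewrite /rel_comm !(mul0r, addr0, subrr, scaler0).
have z' i j l : rel_anti (fun=> 0 : A) i j l = 0.
  by rewrite /rel_anti !(mul0r, addr0, subrr).
rewrite /omega /omega' expr0n !(oppr0, scaler0, addr0); split=> // s.
by rewrite /sklyanin_rels !z !z' !inE !orbb => /eqP.
Qed.

(* The sign by which gamma_g multiplies x_j; Gamma is indexed by 'I_4, with *)
(* g = 0 standing for the identity; gamma_1 gamma_2 = gamma_3.              *)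
Definition gsgn (k : fieldType) (g j : 'I_4) : k :=
  if [|| g == o0, j == o0 | j == g] then 1 else -1.

Section RelatorsGamma.
Variables (k : fieldType) (A : algType k) (x : 'I_4 -> A) (g : 'I_4).
Local Notation y := (fun j => gsgn k g j *: x j).

Lemma gsgn_sqr j : gsgn k g j * gsgn k g j = 1.
Proof. by rewrite /gsgn; case: ifP; rewrite ?mulrNN mulr1. Qed.

Lemma gsgn_mul i j l : (i, j, l) \in [:: (o1, o2, o3); (o2, o3, o1); (o3, o1, o2)] ->
  gsgn k g j * gsgn k g l = gsgn k g i.
Proof.
rewrite !inE => /or3P[] /eqP[-> -> ->]; rewrite /gsgn;
case: g => [[|[|[|[|//]]]] ?] /=; rewrite ?(mulrNN, mulr1, mul1r) //.
Qed.

Lemma gsgn_mulZ i j : (gsgn k g i *: x i) * (gsgn k g j *: x j)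
  = (gsgn k g i * gsgn k g j) *: (x i * x j).
Proof. by rewrite -scalerAl -scalerAr scalerA. Qed.

Lemma gsgn0 : gsgn k g o0 = 1.
Proof. by rewrite /gsgn eqxx orbT. Qed.

Lemma rel_comm_gamma a i j l :
  (i, j, l) \in [:: (o1, o2, o3); (o2, o3, o1); (o3, o1, o2)] ->
  rel_comm y a i j l = gsgn k g i *: rel_comm x a i j l.
Proof.
move=> ijl; rewrite /rel_comm !gsgn_mulZ gsgn0 mulr1 mul1r.
rewrite [gsgn k g l * _]mulrC (gsgn_mul ijl) -scalerDr -scalerBr.
by rewrite [in RHS]scalerBr !scalerA mulrC scalerBr.
Qed.

Lemma rel_anti_gamma i j l :
  (i, j, l) \in [:: (o1, o2, o3); (o2, o3, o1); (o3, o1, o2)] ->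
  rel_anti y i j l = gsgn k g i *: rel_anti x i j l.
Proof.
move=> ijl; rewrite /rel_anti !gsgn_mulZ gsgn0 mulr1 mul1r.
by rewrite [gsgn k g l * _]mulrC (gsgn_mul ijl) -scalerDr -!scalerBr.
Qed.

Lemma omega_gamma : omega y = omega x.
Proof. by rewrite /omega !expr2 !gsgn_mulZ !gsgn_sqr !scale1r. Qed.

Lemma omega'_gamma a1 a2 a3 : omega' y a1 a2 a3 = omega' x a1 a2 a3.
Proof. by rewrite /omega' !expr2 !gsgn_mulZ !gsgn_sqr !scale1r. Qed.

Lemma sklyanin_rels_gamma a1 a2 a3 :
  (forall s, s \in sklyanin_rels x a1 a2 a3 -> s = 0) ->
  forall s, s \in sklyanin_rels y a1 a2 a3 -> s = 0.
Proof.
move=> x0 s; rewrite /sklyanin_rels.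
rewrite !(rel_comm_gamma, rel_anti_gamma) ?inE ?eqxx ?orbT //.
do 5?[case/orP]; move/eqP->; rewrite [X in _ *: X]x0 ?scaler0 // /sklyanin_rels;
  by rewrite ?inE ?eqxx ?orbT.
Qed.

End RelatorsGamma.

Section Sklyanin.
Variables (k : fieldType) (a1 a2 a3 : k).

Definition Qrels : seq (freealg k 4) :=
  sklyanin_rels (@fgen k 4) a1 a2 a3.

Lemma fsubst_Qrels (A : algType k) (v : 'I_4 -> A) :
  (forall s, s \in sklyanin_rels v a1 a2 a3 -> s = 0) ->
  forall s, s \in Qrels -> fsubst v s = 0.
Proof.
move=> v0 s /(map_f (fsubst v)).
rewrite /Qrels (sklyanin_rels_morph (fsubst v)).
have E : fsubst v \o @fgen k 4 = v by apply/funext => j; exact: fsubst_gen.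
by rewrite E; exact: v0.
Qed.

(* The augmentation x_j |-> 0 shows that the ideals are proper. *)
Lemma Qrels_aug s : s \in Qrels -> fsubst (fun=> 0 : k^o) s = 0.
Proof. by apply: fsubst_Qrels; case: (relators0 k^o a1 a2 a3). Qed.

Fact Qrels_proper : 1 \notin tsideal Qrels.
Proof. exact: tsideal_proper Qrels_aug. Qed.

Definition sklQ : Type := quoalg Qrels_proper.
HB.instance Definition _ := GRing.Algebra.on sklQ.

Definition xQ (j : 'I_4) : sklQ := qproj Qrels_proper (fgen k j).

Definition Brels : seq sklQ := [:: omega xQ; omega' xQ a1 a2 a3].

Lemma Brels_aug s : s \in Brels -> qlift Qrels_proper Qrels_aug s = 0.
Proof.
have [_ w w'] := relators0 k^o a1 a2 a3.
have aug0 : qlift Qrels_proper Qrels_aug \o xQ = fun=> 0.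
  by apply/funext => j; rewrite /comp /xQ qliftE; exact: fsubst_gen.
by rewrite !inE => /orP[] /eqP->; rewrite (omega_morph, omega'_morph) aug0.
Qed.

Fact Brels_proper : 1 \notin tsideal Brels.
Proof. exact: tsideal_proper Brels_aug. Qed.

Definition sklB : Type := quoalg Brels_proper.
HB.instance Definition _ := GRing.Algebra.on sklB.

Definition xB (j : 'I_4) : sklB := qproj Brels_proper (xQ j).

Lemma xQ_rels s : s \in sklyanin_rels xQ a1 a2 a3 -> s = 0.
Proof.
have -> : xQ = qproj Qrels_proper \o @fgen k 4 by [].
rewrite -sklyanin_rels_morph => /mapP[t tQ ->].
by apply/eqP; rewrite qproj_eq0 tsideal_gen.
Qed.

Definition gammaQ (g : 'I_4) : sklQ -> sklQ :=
  qlift Qrels_proper (fsubst_Qrels (sklyanin_rels_gamma (g := g) xQ_rels)).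
HB.instance Definition _ g := GRing.LRMorphism.on (gammaQ g).

Lemma gammaQ_gen g j : gammaQ g (xQ j) = gsgn k g j *: xQ j.
Proof. by rewrite /gammaQ /xQ qliftE; exact: fsubst_gen. Qed.

Lemma gammaQ_Brels g s :
  s \in Brels -> (qproj Brels_proper \o gammaQ g) s = 0.
Proof.
have gx : gammaQ g \o xQ = fun j => gsgn k g j *: xQ j.
  by apply/funext => j; exact: gammaQ_gen.
move=> sB; suff gs : gammaQ g s = s.
  by apply/eqP; rewrite /= gs qproj_eq0 tsideal_gen.
move: sB; rewrite !inE => /orP[] /eqP->.
  by rewrite omega_morph gx omega_gamma.
by rewrite omega'_morph gx omega'_gamma.
Qed.

Definition gammaB (g : 'I_4) : sklB -> sklB := qlift Brels_proper (@gammaQ_Brels g).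
HB.instance Definition _ g := GRing.LRMorphism.on (gammaB g).

Lemma gammaB_proj g a :
  gammaB g (qproj Brels_proper a) = qproj Brels_proper (gammaQ g a).
Proof. by rewrite /gammaB qliftE. Qed.

Lemma gammaB_gen g j : gammaB g (xB j) = gsgn k g j *: xB j.
Proof. by rewrite gammaB_proj gammaQ_gen linearZ. Qed.

End Sklyanin.

Section MatrixTensor.
Variables (k : fieldType) (B : algType k) (n : nat).

(* b (x) a, with B (x) M_n(k) realised as M_n(B) *)
Definition mxtens (b : B) (a : 'M[k]_n) : 'M[B]_n :=
  map_mx (fun c => c *: b) a.

Lemma mxtensM b b' a a' : mxtens (b * b') (a *m a') = mxtens b a *m mxtens b' a'.
Proof.
apply/matrixP => i j; rewrite !mxE scaler_suml; apply: eq_bigr => l _.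
by rewrite !mxE -scalerAl -scalerAr scalerA.
Qed.

Lemma mxtens_universal (V : zmodType) (f : B -> 'M[k]_n -> V) :
    (forall b b' a, f (b + b') a = f b a + f b' a) ->
    (forall b a a', f b (a + a') = f b a + f b a') ->
    (forall c b a, f (c *: b) a = f b (c *: a)) ->
  exists2 h : {additive 'M[B]_n -> V}, forall b a, h (mxtens b a) = f b a
    & forall h' : {additive 'M[B]_n -> V},
        (forall b a, h' (mxtens b a) = f b a) -> h' =1 h.
Proof.
move=> fl fr fZ.
have f0l a : f 0 a = 0 by apply: (addrI (f 0 a)); rewrite -fl !addr0.
have f0r b : f b 0 = 0 by apply: (addrI (f b 0)); rewrite -fr !addr0.
have fN a b : f (- b) a = - f b a.
  by apply: (addrI (f b a)); rewrite -fl !subrr.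
pose h (M : 'M[B]_n) := \sum_i \sum_j f (M i j) (delta_mx i j).
have h_add : zmod_morphism h.
  move=> M N; rewrite /h -sumrB; apply: eq_bigr => i _.
  by rewrite -sumrB; apply: eq_bigr => j _; rewrite !mxE fl fN.
pose hh := HB.pack_for {additive 'M[B]_n -> V} h
  (GRing.isZmodMorphism.Build _ _ h h_add).
exists hh => [b a|h' h'E M] /=.
  rewrite /h [in RHS](matrix_sum_delta a).
  rewrite (big_morph (f b) (fr b) (f0r b)); apply: eq_bigr => i _.
  rewrite (big_morph (f b) (fr b) (f0r b)); apply: eq_bigr => j _.
  by rewrite mxE fZ.
rewrite {1}(matrix_sum_delta M) raddf_sum; apply: eq_bigr => i _.
rewrite raddf_sum; apply: eq_bigr => j _; rewrite -h'E; congr (h' _).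
apply/matrixP => i' j'; rewrite !mxE.
by case: (_ && _); rewrite ?(mulr1, mulr0, scale1r, scale0r).
Qed.

End MatrixTensor.

Definition mx22 (R : Type) (a b c d : R) : 'M[R]_2 :=
  \matrix_(r, s) if r == ord0 then if s == ord0 then a else b
                 else if s == ord0 then c else d.

(* q_g for g = 0, 1, 2, 3, where ii is the chosen square root of -1 *)
Definition qmx (k : fieldType) (ii : k) (g : 'I_4) : 'M[k]_2 :=
  nth 1%:M [:: 1%:M; mx22 ii 0 0 (- ii); mx22 0 ii ii 0; mx22 0 (-1) 1 0] g.

Lemma qmx_unit (k : fieldType) (ii : k) (g : 'I_4) :
  ii ^+ 2 = -1 -> qmx ii g \in unitmx.
Proof.
rewrite expr2 => ii2.
have q2 a b c : a * a + b * c = -1 ->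
    mx22 a b c (- a) *m - mx22 a b c (- a) = 1%:M :> 'M[k]_2.
  move=> abc; apply/matrixP => -[[|[|//]] ?] [[|[|//]] ?];
  rewrite !mxE !big_ord_recl big_ord0 !mxE /= addr0 ?mulrNN ?mulrN ?mulNr.
  - by rewrite -opprD abc opprK.
  - by rewrite opprK mulrC addNr.
  - by rewrite [c * a]mulrC addNr.
  - by rewrite [c * b]mulrC addrC -opprD abc opprK.
case: g => [[|[|[|[|//]]]] ?]; rewrite /qmx /= ?unitmx1 //.
- by have [] := mulmx1_unit (q2 ii 0 0 _); rewrite // mulr0 addr0.
- by have := q2 0 ii ii; rewrite oppr0 mulr0 add0r => /(_ ii2) /mulmx1_unit[].
- by have := q2 0 (-1) 1; rewrite oppr0 mulr0 add0r mulr1 => /(_ erefl) /mulmx1_unit[].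
Qed.

Section Twist.
Variables (k : fieldType) (B : algType k) (gam : 'I_4 -> {lrmorphism B -> B}).
Variable ii : k.
Local Notation scal := (map_mx (in_alg B)).

(* Diagonal action of gamma_g on B (x) M_2(k) = M_2(B) *)
Definition gammaM (g : 'I_4) (M : 'M[B]_2) : 'M[B]_2 :=
  scal (qmx ii g) *m map_mx (gam g) M *m scal (invmx (qmx ii g)).

Lemma gammaM_tens g b a :
  gammaM g (mxtens b a)
  = mxtens (gam g b) (qmx ii g *m a *m invmx (qmx ii g)).
Proof.
have scalE q : scal q = mxtens (1 : B) q by [].
rewrite /gammaM !scalE (_ : map_mx _ _ = mxtens (gam g b) a).
  by rewrite -!mxtensM mul1r mulr1.
by apply/matrixP => i j; rewrite !mxE linearZ.
Qed.

Hypothesis ii2 : ii ^+ 2 = -1.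

(* The invariants (B (x) M_2(k))^Gamma. The proof of ii ^+ 2 = -1 is only a *)
(* parameter: it makes the q_g invertible, hence the predicate a subring.  *)
Definition Btwist_pred of ii ^+ 2 = -1 : {pred 'M[B]_2} :=
  fun M => [forall g, gammaM g M == M].

Local Notation P := (Btwist_pred ii2).

Lemma Btwist_predP M : reflect (forall g, gammaM g M = M) (M \in P).
Proof. exact: 'forall_eqP. Qed.

Fact gammaM_is_zmod_morphism g : zmod_morphism (gammaM g).
Proof. by move=> M N; rewrite /gammaM map_mxB mulmxBr mulmxBl. Qed.

Fact gammaM_is_monoid_morphism g : monoid_morphism (gammaM g).
Proof.
have qV : scal (invmx (qmx ii g)) *m scal (qmx ii g) = 1%:M.
  by rewrite -map_mxM mulVmx ?qmx_unit // map_mx1.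
have qK : scal (qmx ii g) *m scal (invmx (qmx ii g)) = 1%:M.
  by rewrite -map_mxM mulmxV ?qmx_unit // map_mx1.
split=> [|M N]; first by rewrite /gammaM map_mx1 mulmx1 qK.
rewrite -[M * N]/(M *m N) -[RHS]/(gammaM g M *m gammaM g N) /gammaM map_mxM.
rewrite -!mulmxA; congr (_ *m (_ *m _)).
by rewrite [RHS]mulmxA qV mul1mx.
Qed.

Fact Btwist_subring_closed : subring_closed P.
Proof.
split=> [|M N /Btwist_predP MP /Btwist_predP NP
         |M N /Btwist_predP MP /Btwist_predP NP]; apply/Btwist_predP => g.
- by rewrite (gammaM_is_monoid_morphism g).1.
- by rewrite gammaM_is_zmod_morphism MP NP.
- by rewrite (gammaM_is_monoid_morphism g).2 MP NP.
Qed.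
HB.instance Definition _ :=
  GRing.isSubringClosed.Build 'M[B]_2 P Btwist_subring_closed.

Record Btwist := MkBtwist { Btwist_val : 'M[B]_2; _ : Btwist_val \in P }.
HB.instance Definition _ := [isSub for Btwist_val].
HB.instance Definition _ := [Choice of Btwist by <:].
HB.instance Definition _ := [SubChoice_isSubNzRing of Btwist by <:].

End Twist.

Definition Btilde (k : fieldType) (a1 a2 a3 ii : k) (ii2 : ii ^+ 2 = -1) : Type :=
  Btwist (fun g => gammaB (a1 := a1) (a2 := a2) (a3 := a3) g) ii2.
HB.instance Definition _ (k : fieldType) (a1 a2 a3 ii : k) ii2 :=
  GRing.NzRing.on (@Btilde k a1 a2 a3 ii ii2).

(* Main.v *)
(* Let E be the elliptic curve in P^3 cut out by x_0^2 + ... + x_3^2 and a second *)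
(* diagonal quadric. The relations of B are satisfied by consecutive points p,    *)
(* sigma p of E, where sigma is a translation, so that an element of degree n     *)
(* takes a value along the chain p, sigma p, ..., sigma^(n-1) p.                  *)
(*                                                                                *)
(* E is irreducible in the following sense: the functions of a fixed weight under *)
(* Gamma have the form u A(x_0^2) + v B(x_0^2) with monomials u, v, and the two   *)
(* terms of the norm u^2 A^2 - v^2 B^2 have degrees of different parity. Hence a  *)
(* product of nonzero homogeneous functions is nonzero.                           *)
(*                                                                                *)
(* An element b of B, homogeneous for the degree and the weight, that vanishes    *)
(* along all chains is zero. Indeed, if x_0(p) = 0, then the homogeneous parts of *)
(* B / x_0 B are at most one-dimensional and detected by the value along the      *)
(* chain of p; so b = x_0 b', and b' again vanishes along all chains.             *)
(*                                                                                *)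
(* If a, b in the twisted algebra are nonzero and a (x_u (x) q_u) b = 0 for all   *)
(* u, then the values U, W of their lowest components along a general chain       *)
(* satisfy U q_u W = 0. As the q_u span the 2 x 2 matrices, U = 0 or W = 0.       *)

Require Import Defs.
From HB Require Import structures.
From mathcomp Require Import all_boot all_algebra.
From mathcomp Require Import boolp finmap monalg ssrAC ring.
Import GRing.Theory.

Set Implicit Arguments.
Unset Strict Implicit.
Unset Printing Implicit Defensive.

Local Open Scope ring_scope.

(** * The elliptic curve and its translation *)

Section Curve.
Variable k : fieldType.

(** Elements of B are tested on chains, that is, sequences of points of E in which consecutive
    points satisfy the relations of B. A chain yields representations of B by weighted shift
    matrices ([evB]), truncations of a point module, and an element of degree n takes a scalar value
    along each stretch of n points. Three facts carry the proof.

    Nonvanishing is generic. Along iterated translations, values are functions of the starting point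
    that are homogeneous for Gamma, and a product of nonzero functions of this kind is nonzero
    ([wfun_neq0M]). So elements that are each nonzero along some chain are nonzero, at prescribed
    positions, along one common chain ([nonvanishing_generic], [common_chain]).

    Values detect elements that are homogeneous for degree and weight ([wcomb_eq0]). Along a chain
    that starts at a point with [x_0 = 0], words of fixed degree and weight are proportional to
    their values modulo x_0 B ([proportional_ge1]). An element that vanishes along all chains is
    thus x_0 times another such element, and induction on the degree applies.

    An invariant matrix is a sum of terms b_j (x) q_j in which b_j has the weight of x_j
    ([Btwist_decomp]), and every x_u (x) q_u is invariant. If a and b are nonzero and lie in ideals
    with product zero, then a (x_u (x) q_u) b = 0. The lowest components along a common chain give
    nonzero U, W in M_2(k) with U q_u W = 0 for all u, contradicting that the q_u span M_2(k)
    ([qmx_cancel]). *)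

Definition generic_alpha (a1 a2 a3 : k) : Prop :=
  [/\ 2 != 0 :> k, a1 + a2 + a3 + a1 * a2 * a3 = 0,
      [/\ a1 != 0, 1 + a1 != 0 & 1 - a1 != 0],
      [/\ a2 != 0, 1 + a2 != 0 & 1 - a2 != 0]
    & [/\ a3 != 0, 1 + a3 != 0 & 1 - a3 != 0]].

Lemma generic_cycle a1 a2 a3 : generic_alpha a1 a2 a3 -> generic_alpha a2 a3 a1.
Proof. by case=> ? E ? ? ?; split=> //; rewrite -E; ring. Qed.

(** The second quadric is ((1-a3)/(1+a1)) q1^2 + ((1+a3)/(1-a2)) q2^2 + q3^2 with denominators
    cleared. *)
Definition onE (a1 a2 a3 q0 q1 q2 q3 : k) : Prop :=
  q0 * q0 + q1 * q1 + q2 * q2 + q3 * q3 = 0 /\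
  (1 - a2) * (1 - a3) * (q1 * q1) + (1 + a1) * (1 + a3) * (q2 * q2)
  + (1 + a1) * (1 - a2) * (q3 * q3) = 0.

Section Fixed.
Variables a1 a2 a3 : k.
Hypothesis Ha : generic_alpha a1 a2 a3.

(** The constraint reads a1 + a2 + a3 (1 + a1 a2) = 0. If the coefficient of a3 vanished, so would
    a1 + a2, and then a1^2 = 1. *)
Lemma generic_mul_neq0 : 1 + a1 * a2 != 0.
Proof.
case: Ha => n2 E [n1 p1 m1] [n2' p2 m2] _; apply/eqP => H.
have s : a1 + a2 = 0.
  have -> : a1 + a2 = a1 + a2 + a3 + a1 * a2 * a3 - a3 * (1 + a1 * a2) by ring.
  by rewrite E H mulr0 subr0.
have: (1 + a1) * (1 - a1) == 0.
  rewrite (_ : _ * _ = 1 + a1 * a2 - a1 * (a1 + a2)); last by ring.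
  by rewrite H s mulr0 subr0.
by rewrite mulf_eq0 (negbTE p1) (negbTE m1).
Qed.

Lemma generic_add_neq0 : a1 + a2 != 0.
Proof.
case: Ha => _ E _ _ [n3 _ _]; apply/eqP => H.
have: a3 * (1 + a1 * a2) == 0.
  have -> : a3 * (1 + a1 * a2) = a1 + a2 + a3 + a1 * a2 * a3 - (a1 + a2) by ring.
  by rewrite E H subr0.
by rewrite mulf_eq0 (negbTE n3) (negbTE generic_mul_neq0).
Qed.

Lemma generic_third : a3 = - (a1 + a2) / (1 + a1 * a2).
Proof.
have h := generic_mul_neq0; case: Ha => _ E _ _ _.
apply: (mulIf h); rewrite divfK //; apply/eqP.
by rewrite -subr_eq0 opprK -E; apply/eqP; ring.
Qed.

(** The constraint in product form: the difference of the sides is -2 times its left-hand side. This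
    is what makes the formulas below invariant under cyclic permutation. *)
Lemma generic_prod :
  (1 - a1) * (1 - a2) * (1 - a3) = (1 + a1) * (1 + a2) * (1 + a3).
Proof.
case: Ha => _ E _ _ _; apply/eqP; rewrite -subr_eq0.
rewrite (_ : _ - _ = - 2 * (a1 + a2 + a3 + a1 * a2 * a3)); last by ring.
by rewrite E mulr0.
Qed.

Lemma onE_cycle q0 q1 q2 q3 : onE a1 a2 a3 q0 q1 q2 q3 -> onE a2 a3 a1 q0 q2 q3 q1.
Proof.
have E := generic_prod; case: Ha => _ _ [_ p1 m1] _ [_ p3 m3] [g1 g3].
split; first by rewrite -g1; ring.
apply: (mulfI (mulf_neq0 p1 p3)); rewrite mulr0.
rewrite -[RHS](mulr0 ((1 - a1) * (1 - a3))) -g3; apply/eqP; rewrite -subr_eq0.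
set P := (X in X == 0).
have -> : P = ((1 + a1) * (1 + a2) * (1 + a3) - (1 - a1) * (1 - a2) * (1 - a3))
  * ((1 - a3) * (q1 * q1) + (1 + a1) * (q3 * q3)) by rewrite /P; ring.
by rewrite E subrr mul0r.
Qed.

(* A diagonal quadratic form in the pencil of the curve is determined by its *)
(* first and last coefficients.                                              *)
Lemma onE_pencil (c0 c1 c2 c3 q0 q1 q2 q3 : k) : onE a1 a2 a3 q0 q1 q2 q3 ->
  (1 + a1) * (c1 - c0) = (1 - a3) * (c3 - c0) ->
  (1 - a2) * (c2 - c0) = (1 + a3) * (c3 - c0) ->
  c0 * (q0 * q0) + c1 * (q1 * q1) + c2 * (q2 * q2) + c3 * (q3 * q3) = 0.
Proof.
case: Ha => _ _ [_ p1 m1] [_ p2 m2] _ [g1 g3] h1 h2.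
apply: (mulfI (mulf_neq0 p1 m2)); rewrite mulr0.
rewrite (_ : (1 + a1) * (1 - a2) * _ =
   (1 + a1) * (1 - a2) * c0 * (q0 * q0 + q1 * q1 + q2 * q2 + q3 * q3)
   + (1 - a2) * (q1 * q1) * ((1 + a1) * (c1 - c0))
   + (1 + a1) * (q2 * q2) * ((1 - a2) * (c2 - c0))
   + (1 + a1) * (1 - a2) * (c3 - c0) * (q3 * q3)); last by ring.
rewrite h1 h2 g1 mulr0 add0r -[RHS](mulr0 (c3 - c0)) -g3; ring.
Qed.

Ltac solve_third :=
  let h := fresh in have h := generic_mul_neq0;
  rewrite generic_third; field; exact: h.

Lemma onE_squares q0 q1 q2 q3 : onE a1 a2 a3 q0 q1 q2 q3 ->
  q2 * q2 = (- (1 + a1 * a2) * (q0 * q0) + a2 * (1 - a1) * (q1 * q1)) / (a1 * (1 + a2)) /\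
  q3 * q3 = ((1 - a1) * (q0 * q0) - (a1 + a2) * (q1 * q1)) / (a1 * (1 + a2)).
Proof.
move=> qE; have := Ha; case=> _ _ [n1 p1 m1] [n2 p2 m2] _.
have d : a1 * (1 + a2) != 0 by rewrite mulf_neq0.
split; apply: (mulIf d); rewrite divfK //; apply/eqP; rewrite -subr_eq0; apply/eqP.
  rewrite -(@onE_pencil (1 + a1 * a2) (- (a2 * (1 - a1))) (a1 * (1 + a2)) 0 _ _ _ _ qE).
  - by ring.
  - solve_third.
  - solve_third.
rewrite -(@onE_pencil (- (1 - a1)) (a1 + a2) 0 (a1 * (1 + a2)) _ _ _ _ qE).
- by ring.
- solve_third.
- solve_third.
Qed.

Lemma squares_onE q0 q1 q2 q3 :
  q2 * q2 = (- (1 + a1 * a2) * (q0 * q0) + a2 * (1 - a1) * (q1 * q1)) / (a1 * (1 + a2)) ->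
  q3 * q3 = ((1 - a1) * (q0 * q0) - (a1 + a2) * (q1 * q1)) / (a1 * (1 + a2)) ->
  onE a1 a2 a3 q0 q1 q2 q3.
Proof.
move=> h2 h3; have h := generic_mul_neq0; have := Ha; case=> _ _ [n1 p1 m1] [n2 p2 m2] _.
split; rewrite h2 h3 ?generic_third; field; rewrite ?n1 ?p2 ?h //.
Qed.

Section Step.
Variables q0 q1 q2 q3 : k.
Hypothesis qE : onE a1 a2 a3 q0 q1 q2 q3.

Let s0 := 2 * (a1 + a2) * (q1 * q2) + (1 + a1) * (1 - a2) * (q0 * q3).
Let s1 := (1 - a1) * (1 - a2) * (q1 * q3) + 2 * (1 + a1) * (q0 * q2).
Let s2 := (1 + a1) * (1 + a2) * (q2 * q3) - 2 * (1 - a2) * (q0 * q1).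
Let s3 := 4 * (q0 * q0) + (1 - a1) * (1 + a2) * (q3 * q3).

Let pencil c0 c1 c2 c3 := @onE_pencil c0 c1 c2 c3 _ _ _ _ qE.

(** The first two relations hold identically, since (s1, s2, s3) is the vector product of their
    rows. The other two are [q2] and [q1] times forms of the pencil, whose coefficients come from
    expanding. *)
Lemma step_rel12 :
  [/\ 2 * (q0 * s1) - (1 + a1) * (q2 * s3) + (1 - a1) * (q3 * s2) = 0,
      2 * (q0 * s2) - (1 + a2) * (q3 * s1) + (1 - a2) * (q1 * s3) = 0,
      2 * (q1 * s0) - (1 - a1) * (q2 * s3) + (1 + a1) * (q3 * s2) = 0
    & 2 * (q2 * s0) - (1 - a2) * (q3 * s1) + (1 + a2) * (q1 * s3) = 0].
Proof.
rewrite /s0 /s1 /s2 /s3; split; [by ring|by ring| |].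
  rewrite -[RHS](mulr0 q2).
  rewrite -(@pencil (- 4 * (1 - a1)) (4 * (a1 + a2)) 0 (4 * a1 * (1 + a2))).
  - by ring.
  - solve_third.
  - solve_third.
rewrite -[RHS](mulr0 q1).
rewrite -(@pencil (4 * (1 + a2)) 0 (4 * (a1 + a2)) (4 * a2 * (1 - a1))).
- by ring.
- solve_third.
- solve_third.
Qed.

Lemma step_rel3 :
  2 * (q0 * s3) - (1 + a3) * (q1 * s2) + (1 - a3) * (q2 * s1) = 0 /\
  2 * (q3 * s0) - (1 - a3) * (q1 * s2) + (1 + a3) * (q2 * s1) = 0.
Proof.
(* Each relation is [q0] times a form of the pencil plus [q1 * q2 * q3] times a constant that the
   constraint on the alphas makes zero. *)
have H (c d X Y Z : k) : c = 0 -> Y = 0 -> X = Y * Z + c * d -> X = 0.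
  by move=> -> -> ->; rewrite !mul0r addr0.
rewrite /s0 /s1 /s2 /s3; split.
  apply: (H ((1 - a1) * (1 - a2) * (1 - a3) - (1 + a1) * (1 + a2) * (1 + a3))
    (q1 * q2 * q3) _ _ q0); first by rewrite generic_prod subrr.
    apply: (@pencil 8 (2 * (1 + a3) * (1 - a2)) (2 * (1 - a3) * (1 + a1)) (2 * (1 - a1) * (1 +
      a2))).
    - solve_third.
    - solve_third.
  by ring.
apply: (H (4 * (a1 + a2) - (1 - a3) * (1 + a1) * (1 + a2) + (1 + a3) * (1 - a1) * (1 - a2))
    (q1 * q2 * q3) _ _ q0).
- solve_third.
- apply: (@pencil 0 (2 * (1 - a2) * (1 - a3)) (2 * (1 + a1) * (1 + a3)) (2 * (1 + a1) * (1 - a2))).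
  + solve_third.
  + solve_third.
- by ring.
Qed.

Lemma step_omega :
  - (q0 * s0) + q1 * s1 + q2 * s2 + q3 * s3 = 0 /\
  (1 - a2) * (1 + a3) * (q1 * s1) + (1 + a1) * (1 + a3) * (q2 * s2)
  + (1 - a1) * (1 - a2) * (q3 * s3) = 0.
Proof.
rewrite /s0 /s1 /s2 /s3; split; rewrite -[RHS](mulr0 q3).
  rewrite -(@pencil (4 - (1 + a1) * (1 - a2)) ((1 - a1) * (1 - a2)) ((1 + a1) * (1 + a2)) ((1 -
    a1) * (1 + a2))).
  - by ring.
  - solve_third.
  - solve_third.
rewrite -(@pencil (4 * (1 - a1) * (1 - a2)) ((1 - a2) ^+ 2 * (1 + a3) * (1 - a1))
   ((1 + a1) ^+ 2 * (1 + a2) * (1 + a3)) ((1 - a1) ^+ 2 * (1 - a2) * (1 + a2))).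
- by ring.
- solve_third.
- solve_third.
Qed.

(** Apart from the monomial q0 q1 q2 q3, both quadrics at s involve only squares, so [onE_squares]
    applies. The mixed monomial cancels in the first quadric and has a coefficient that is zero by
    [generic_prod] in the second. *)
Lemma step_onE : onE a1 a2 a3 s0 s1 s2 s3.
Proof.
have [h2 h3] := onE_squares qE.
have h := generic_mul_neq0; have := Ha; case=> _ _ [n1 p1 m1] [n2 p2 m2] _.
have E := generic_prod.
have H (c d X Y : k) : c = 0 -> Y = 0 -> X = Y + c * d -> X = 0.
  by move=> -> -> ->; rewrite !mul0r addr0.
rewrite /s0 /s1 /s2 /s3; split.
  rewrite [LHS](_ : _ = 4 * (a1 + a2) ^+ 2 * ((q1 * q1) * (q2 * q2))
    + ((1 + a1) * (1 - a2)) ^+ 2 * ((q0 * q0) * (q3 * q3))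
    + ((1 - a1) * (1 - a2)) ^+ 2 * ((q1 * q1) * (q3 * q3))
    + 4 * (1 + a1) ^+ 2 * ((q0 * q0) * (q2 * q2))
    + ((1 + a1) * (1 + a2)) ^+ 2 * ((q2 * q2) * (q3 * q3))
    + 4 * (1 - a2) ^+ 2 * ((q0 * q0) * (q1 * q1))
    + (4 * (q0 * q0) + (1 - a1) * (1 + a2) * (q3 * q3)) ^+ 2); last by ring.
  by rewrite h2 h3; field; rewrite ?n1 ?p2.
apply: (H ((1 - a1) * (1 - a2) * (1 - a3) - (1 + a1) * (1 + a2) * (1 + a3))
    (4 * (1 - a2) * (1 + a1) * (q0 * q1 * q2 * q3)) _
    ((1 - a2) * (1 - a3) * (((1 - a1) * (1 - a2)) ^+ 2 * ((q1 * q1) * (q3 * q3))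
      + 4 * (1 + a1) ^+ 2 * ((q0 * q0) * (q2 * q2)))
    + (1 + a1) * (1 + a3) * (((1 + a1) * (1 + a2)) ^+ 2 * ((q2 * q2) * (q3 * q3))
      + 4 * (1 - a2) ^+ 2 * ((q0 * q0) * (q1 * q1)))
    + (1 + a1) * (1 - a2) * (4 * (q0 * q0) + (1 - a1) * (1 + a2) * (q3 * q3)) ^+ 2)).
- by rewrite E subrr.
- by rewrite h2 h3 generic_third; field; rewrite ?n1 ?p2 ?h.
- by ring.
Qed.

End Step.
End Fixed.
End Curve.

(** * Uniqueness of the next point *)

Section Uniqueness.
Variable k : fieldType.

Definition rA (a q0 qi qj ql y0 yi yj yl : k) :=
  2 * (q0 * yi) - (1 + a) * (qj * yl) + (1 - a) * (ql * yj) = 0.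
Definition rC (a q0 qi qj ql y0 yi yj yl : k) :=
  2 * (qi * y0) - (1 - a) * (qj * yl) + (1 + a) * (ql * yj) = 0.

Section Fixed.
Variables a1 a2 a3 : k.
Hypothesis Ha : generic_alpha a1 a2 a3.
Variables q0 q1 q2 q3 : k.
Hypothesis qE : onE a1 a2 a3 q0 q1 q2 q3.

Lemma onE_01 : q0 = 0 -> q1 = 0 -> q2 = 0 /\ q3 = 0.
Proof.
move=> h0 h1; have [] := onE_squares Ha qE.
rewrite h0 h1 !mulr0 addr0 subrr !mul0r => /eqP + /eqP.
by rewrite !mulf_eq0 !orbb => /eqP-> /eqP->.
Qed.

Lemma onE_neq23 : q0 = 0 -> q1 != 0 -> q2 != 0 /\ q3 != 0.
Proof.
move=> h0 h1; have [] := onE_squares Ha qE.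
have s := generic_add_neq0 Ha.
case: Ha => _ _ [n1 p1 m1] [n2 p2 m2] _.
rewrite h0 !mulr0 add0r sub0r => e2 e3; split.
  apply/eqP => z; move/eqP: e2; rewrite z mulr0 eq_sym.
  by rewrite !(mulf_eq0, invr_eq0) (negbTE n1) (negbTE n2) (negbTE p2) (negbTE m1) (negbTE h1).
apply/eqP => z; move/eqP: e3; rewrite z mulr0 eq_sym.
by rewrite !(mulf_eq0, oppr_eq0, invr_eq0) (negbTE n1) (negbTE s) (negbTE p2) (negbTE h1).
Qed.

Lemma onE_neq12 : q0 != 0 -> q1 != 0 \/ q2 != 0.
Proof.
move=> h0; case: (eqVneq q1 0) => [h1|]; [right|by left].
have [e2 _] := onE_squares Ha qE.
have h := generic_mul_neq0 Ha; case: Ha => _ _ [n1 p1 m1] [n2 p2 m2] _.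
apply/eqP => z; move/eqP: e2; rewrite z h1 !mulr0 addr0 eq_sym.
by rewrite !(mulf_eq0, oppr_eq0, invr_eq0) (negbTE n1) (negbTE h) (negbTE p2) (negbTE h0).
Qed.

(* The three diagonal minors add up to a nonzero multiple of [q0 * q0]. *)
Lemma onE_minor : q0 != 0 ->
  [\/ 4 * (q0 * q0) + (1 - a2) * (1 + a3) * (q1 * q1) != 0,
      4 * (q0 * q0) + (1 - a3) * (1 + a1) * (q2 * q2) != 0
    | 4 * (q0 * q0) + (1 - a1) * (1 + a2) * (q3 * q3) != 0].
Proof.
move=> h0; set d1 := _ + _; set d2 := (X in [\/ _, X != 0 | _]).
set d3 := (X in [\/ _, _ | X != 0]).
case: (eqVneq d1 0) => [z1|]; last by constructor 1.
case: (eqVneq d2 0) => [z2|]; last by constructor 2.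
case: (eqVneq d3 0) => [z3|]; last by constructor 3.
have h := generic_mul_neq0 Ha.
have P : 4 * (q0 * q0) + (1 - a2) * (1 + a3) * (q1 * q1)
    + (1 - a3) * (1 + a1) * (q2 * q2) + (1 - a1) * (1 + a2) * (q3 * q3) = 0.
  apply: (onE_pencil Ha qE); rewrite (generic_third Ha); field; exact: h.
have : 2 * 2 * 2 * (q0 * q0) = d1 + d2 + d3 -
  (4 * (q0 * q0) + (1 - a2) * (1 + a3) * (q1 * q1)
    + (1 - a3) * (1 + a1) * (q2 * q2) + (1 - a1) * (1 + a2) * (q3 * q3)).
  by rewrite /d1 /d2 /d3; ring.
rewrite z1 z2 z3 P !addr0 subr0 => /eqP.
by case: Ha => n2 _ _ _ _; rewrite !mulf_eq0 (negbTE n2) (negbTE h0).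
Qed.
End Fixed.

(** Cramer's rule for the first two rows: the nonzero minor expresses coordinates 1 and 2 of every
    solution through coordinate 3. *)
Lemma kernel_minor (a1 a2 q0 q1 q2 q3 y0 y1 y2 y3 x0 x1 x2 x3 : k) :
  4 * (q0 * q0) + (1 - a1) * (1 + a2) * (q3 * q3) != 0 ->
  rA a1 q0 q1 q2 q3 y0 y1 y2 y3 -> rA a2 q0 q2 q3 q1 y0 y2 y3 y1 ->
  rA a1 q0 q1 q2 q3 x0 x1 x2 x3 -> rA a2 q0 q2 q3 q1 x0 x2 x3 x1 ->
  [/\ y1 * x2 = y2 * x1, y1 * x3 = y3 * x1 & y2 * x3 = y3 * x2].
Proof.
set d := (X in X != 0) => d0.
have H z0 z1 z2 z3 : rA a1 q0 q1 q2 q3 z0 z1 z2 z3 -> rA a2 q0 q2 q3 q1 z0 z2 z3 z1 ->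
   d * z1 = ((1 - a1) * (1 - a2) * (q1 * q3) + 2 * (1 + a1) * (q0 * q2)) * z3 /\
   d * z2 = ((1 + a1) * (1 + a2) * (q2 * q3) - 2 * (1 - a2) * (q0 * q1)) * z3.
  rewrite /rA => h1 h2; split; apply/eqP; rewrite -subr_eq0; apply/eqP.
    rewrite (_ : _ - _ = 2 * q0 * (2 * (q0 * z1) - (1 + a1) * (q2 * z3) + (1 - a1) * (q3 * z2))
      - (1 - a1) * q3 * (2 * (q0 * z2) - (1 + a2) * (q3 * z1) + (1 - a2) * (q1 * z3))).
      by rewrite h1 h2 !mulr0 subr0.
    by rewrite /d; ring.
  rewrite (_ : _ - _ = 2 * q0 * (2 * (q0 * z2) - (1 + a2) * (q3 * z1) + (1 - a2) * (q1 * z3))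
      + (1 + a2) * q3 * (2 * (q0 * z1) - (1 + a1) * (q2 * z3) + (1 - a1) * (q3 * z2))).
    by rewrite h1 h2 !mulr0 addr0.
  by rewrite /d; ring.
move=> /H H1 /H1 [e1 e2] /H H2 /H2 [f1 f2] {H H1 H2}.
split; apply: (mulfI (mulf_neq0 d0 d0)).
- rewrite (_ : _ * (y1 * x2) = (d * y1) * (d * x2)); last by ring.
  rewrite (_ : _ * (y2 * x1) = (d * y2) * (d * x1)); last by ring.
  by rewrite e1 e2 f1 f2; ring.
- rewrite (_ : _ * (y1 * x3) = (d * y1) * (d * x3)); last by ring.
  rewrite (_ : _ * (y3 * x1) = (d * y3) * (d * x1)); last by ring.
  by rewrite e1 f1; ring.
- rewrite (_ : _ * (y2 * x3) = (d * y2) * (d * x3)); last by ring.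
  rewrite (_ : _ * (y3 * x2) = (d * y3) * (d * x2)); last by ring.
  by rewrite e2 f2; ring.
Qed.

Lemma rA0_minor a qi qj ql y0 yi yj yl x0 xi xj xl :
  1 + a != 0 -> qj != 0 ->
  rA a 0 qi qj ql y0 yi yj yl -> rA a 0 qi qj ql x0 xi xj xl ->
  yj * xl = yl * xj.
Proof.
rewrite /rA !mul0r !mulr0 !add0r => pa nj /eqP + /eqP.
rewrite !(addrC (- _)) !subr_eq0 => /eqP hy /eqP hx.
apply: (mulfI (mulf_neq0 pa nj)).
rewrite (_ : _ * (yj * xl) = yj * ((1 + a) * (qj * xl))); last by ring.
rewrite (_ : _ * (yl * xj) = xj * ((1 + a) * (qj * yl))); last by ring.
by rewrite -hy -hx; ring.
Qed.

Lemma rC_minor a q0 qi qj ql y0 yi yj yl x0 xi xj xl :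
  2 != 0 :> k -> qi != 0 ->
  rC a q0 qi qj ql y0 yi yj yl -> rC a q0 qi qj ql x0 xi xj xl ->
  [/\ yi * xj = yj * xi, yi * xl = yl * xi & yj * xl = yl * xj] ->
  [/\ y0 * xi = x0 * yi, y0 * xj = x0 * yj & y0 * xl = x0 * yl].
Proof.
rewrite /rC => n2 ni hy hx [ij il jl].
have H z0 zj zl : 2 * (qi * z0) - (1 - a) * (qj * zl) + (1 + a) * (ql * zj) = 0 ->
   2 * qi * z0 = (1 - a) * (qj * zl) - (1 + a) * (ql * zj).
  by move=> h; rewrite -[LHS]subr0 -h; ring.
have K ym xm : yj * xm = ym * xj -> yl * xm = ym * xl -> y0 * xm = x0 * ym.
  move=> ej el; apply: (mulfI (mulf_neq0 n2 ni)).
  rewrite !mulrA (H _ _ _ hy) (H _ _ _ hx) !mulrBl -!(mulrA _ _ xm) ej el; ring.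
by split; apply: K; rewrite // mulrC // ?ij ?il ?jl // mulrC.
Qed.

Definition on_kernel (a1 a2 a3 q0 q1 q2 q3 y0 y1 y2 y3 : k) : Prop :=
  [/\ rA a1 q0 q1 q2 q3 y0 y1 y2 y3 /\ rC a1 q0 q1 q2 q3 y0 y1 y2 y3,
      rA a2 q0 q2 q3 q1 y0 y2 y3 y1 /\ rC a2 q0 q2 q3 q1 y0 y2 y3 y1
    & rA a3 q0 q3 q1 q2 y0 y3 y1 y2 /\ rC a3 q0 q3 q1 q2 y0 y3 y1 y2].

(** If [q0] is nonzero, one of the three minors of [onE_minor] is. If [q0 = 0], the relations [rA]
    have two terms each, with coefficients that do not vanish. A relation [rC] with nonzero leading
    coordinate then fixes coordinate 0. *)
Lemma kernel_line a1 a2 a3 q0 q1 q2 q3 y0 y1 y2 y3 x0 x1 x2 x3 :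
  generic_alpha a1 a2 a3 -> onE a1 a2 a3 q0 q1 q2 q3 -> q0 != 0 \/ q1 != 0 ->
  on_kernel a1 a2 a3 q0 q1 q2 q3 y0 y1 y2 y3 ->
  on_kernel a1 a2 a3 q0 q1 q2 q3 x0 x1 x2 x3 ->
  [/\ y1 * x2 = y2 * x1, y1 * x3 = y3 * x1 & y2 * x3 = y3 * x2] /\
  [/\ y0 * x1 = x0 * y1, y0 * x2 = x0 * y2 & y0 * x3 = x0 * y3].
Proof.
move=> Ha qE q01 [[yA1 yC1] [yA2 yC2] [yA3 yC3]] [[xA1 xC1] [xA2 xC2] [xA3 xC3]].
have n2 : 2 != 0 :> k by case: Ha.
have H : [/\ y1 * x2 = y2 * x1, y1 * x3 = y3 * x1 & y2 * x3 = y3 * x2].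
  case: (eqVneq q0 0) => [h0|n0]; last first.
    case: (onE_minor Ha qE n0) => d.
    - by have [? ? ?] := kernel_minor d yA2 yA3 xA2 xA3; split.
    - by have [? ? ?] := kernel_minor d yA3 yA1 xA3 xA1; split.
    - by have [? ? ?] := kernel_minor d yA1 yA2 xA1 xA2; split.
  case: q01 => [|n1]; first by rewrite h0 eqxx.
  have [nq2 nq3] := onE_neq23 Ha qE h0 n1.
  case: Ha => _ _ [_ p1 _] [_ p2 _] [_ p3 _]; move: yA1 yA2 yA3 xA1 xA2 xA3.
  rewrite h0 => yA1 yA2 yA3 xA1 xA2 xA3; split.
  - exact: rA0_minor p3 n1 yA3 xA3.
  - by rewrite (rA0_minor p2 nq3 yA2 xA2).
  - exact: rA0_minor p1 nq2 yA1 xA1.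
split=> //; case: H => h12 h13 h23.
case: (eqVneq q1 0) => [h1|n1]; last by apply: (rC_minor n2 n1 yC1 xC1).
have n0 : q0 != 0 by case: q01 => //; rewrite h1 eqxx.
case: (onE_neq12 Ha qE n0) => [|nq2]; first by rewrite h1 eqxx.
by case: (rC_minor n2 nq2 yC2 xC2) => // ? ? ?; split.
Qed.

End Uniqueness.

(** * Homogeneous functions on the curve *)

(* Characters of the group Gamma; [wgen j] is the one through which it acts on *)
(* [x_j].                                                                     *)
Definition weight : Type := (bool * bool)%type.
Definition wadd (s t : weight) : weight := (s.1 (+) t.1, s.2 (+) t.2).
Definition wgen (j : 'I_4) : weight :=
  nth (false, false) [:: (false, false); (true, true); (false, true); (true, false)] j.

Section Functions.
Variables (k : closedFieldType) (a1 a2 a3 : k).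
Hypothesis Ha : generic_alpha a1 a2 a3.

Definition onEp (q : 'I_4 -> k) : Prop := onE a1 a2 a3 (q o0) (q o1) (q o2) (q o3).
Definition onEaff (q : 'I_4 -> k) : Prop := onEp q /\ q o1 = 1.

Definition sqx2 : {poly k} :=
  (- (1 + a1 * a2) / (a1 * (1 + a2))) *: 'X + (a2 * (1 - a1) / (a1 * (1 + a2)))%:P.
Definition sqx3 : {poly k} :=
  ((1 - a1) / (a1 * (1 + a2))) *: 'X + (- (a1 + a2) / (a1 * (1 + a2)))%:P.

Lemma sqx2E q : onEaff q -> sqx2.[q o0 * q o0] = q o2 * q o2.
Proof.
by case=> /(onE_squares Ha)[-> _] ->; rewrite !(hornerD, hornerZ, hornerX, hornerC); ring.
Qed.

Lemma sqx3E q : onEaff q -> sqx3.[q o0 * q o0] = q o3 * q o3.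
Proof.
by case=> /(onE_squares Ha)[_ ->] ->; rewrite !(hornerD, hornerZ, hornerX, hornerC); ring.
Qed.

Lemma size_linear (c d : k) : c != 0 -> size (c *: 'X + d%:P) = 2.
Proof.
move=> c0; rewrite size_polyDl size_scale ?size_polyX //.
exact: leq_ltn_trans (size_polyC_leq1 d) _.
Qed.

Lemma size_sqx : size sqx2 = 2 /\ size sqx3 = 2.
Proof.
have h := generic_mul_neq0 Ha; case: Ha => _ _ [n1 _ m1] [_ p2 _] _.
by split; apply: size_linear; rewrite !(mulf_neq0, oppr_eq0, invr_eq0).
Qed.

Lemma closed_sqrt (s : k) : exists x, x * x = s.
Proof.
have : size ('X^2 - s%:P : {poly k}) != 1 by rewrite size_XnsubC.
case/closed_rootP => x; rewrite rootE !hornerE subr_eq0 expr2 => /eqP e.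
by exists x.
Qed.

Definition mkpt (c0 c1 c2 c3 : k) : 'I_4 -> k := fun u => [:: c0; c1; c2; c3]`_u.

Lemma onEaff_lift (s : k) : exists2 q, onEaff q & q o0 * q o0 = s.
Proof.
have [x0 e0] := closed_sqrt s.
have [x2 e2] := closed_sqrt sqx2.[s]; have [x3 e3] := closed_sqrt sqx3.[s].
exists (mkpt x0 1 x2 x3) => //; split=> //; apply: (squares_onE Ha).
  by rewrite [LHS]e2 /mkpt /= !(hornerD, hornerZ, hornerX, hornerC) -e0; ring.
by rewrite [LHS]e3 /mkpt /= !(hornerD, hornerZ, hornerX, hornerC) -e0; ring.
Qed.

(* On the affine curve [x_1 = 1] the functions that are homogeneous of a given *)
(* weight form a rank two module over the polynomials in [x_0 ^ 2].            *)
Definition wform (t : weight) (A B : {poly k}) (q : 'I_4 -> k) : k :=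
  q o2 ^+ t.1 * q o3 ^+ t.2 * A.[q o0 * q o0]
  + q o0 * (q o2 ^+ (~~ t.1) * q o3 ^+ (~~ t.2)) * B.[q o0 * q o0].

Definition wfun (t : weight) (f : ('I_4 -> k) -> k) : Prop :=
  exists A B : {poly k}, forall q, onEaff q -> f q = wform t A B q.

Lemma wfunM s t f g : wfun s f -> wfun t g ->
  wfun (wadd s t) (fun q => f q * g q).
Proof.
case=> [A [B fE]] [C [D gE]]; case: s t fE gE => [s1 s2] [t1 t2] fE gE.
exists (A * C * sqx2 ^+ (s1 && t1) * sqx3 ^+ (s2 && t2)
     + 'X * (B * D * sqx2 ^+ (~~ s1 && ~~ t1) * sqx3 ^+ (~~ s2 && ~~ t2))).
exists (A * D * sqx2 ^+ (s1 && ~~ t1) * sqx3 ^+ (s2 && ~~ t2)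
     + B * C * sqx2 ^+ (~~ s1 && t1) * sqx3 ^+ (~~ s2 && t2)) => q qE.
have [e2 e3] := (sqx2E qE, sqx3E qE); rewrite fE // gE //.
move: sqx2 sqx3 e2 e3 => P2 P3 e2 e3; rewrite /wform /=.
rewrite !(hornerD, hornerM, hornerX, horner_exp) e2 e3.
by case: s1 {fE}; case: s2; case: t1 {gE}; case: t2; rewrite /= !(expr0, expr1); ring.
Qed.

Lemma wfunD t f g : wfun t f -> wfun t g -> wfun t (fun q => f q + g q).
Proof.
case=> [A [B fE]] [C [D gE]]; exists (A + C), (B + D) => q qE.
by rewrite fE // gE // /wform !hornerD; ring.
Qed.

Lemma wfunZ t c f : wfun t f -> wfun t (fun q => c * f q).
Proof.
case=> [A [B fE]]; exists (c *: A), (c *: B) => q qE.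
by rewrite fE // /wform !hornerZ; ring.
Qed.

Lemma wfun0 t : wfun t (fun=> 0).
Proof. by exists 0, 0 => q _; rewrite /wform !horner0 !mulr0 addr0. Qed.

Lemma wfun1 : wfun (false, false) (fun=> 1).
Proof.
by exists 1, 0 => q _; rewrite /wform horner0 hornerC !expr0 mulr0 addr0 !mulr1.
Qed.

(** Setting [x_1 = 1] amounts to dividing by x_1, which shifts each weight by that of x_1, namely
    [(true, true)]. *)
Lemma wfun_coord j : wfun (wadd (true, true) (wgen j)) (fun q => q j).
Proof.
case: j => [[|[|[|[|//]]]] jP]; rewrite /wgen /wadd /=.
- exists 0, 1 => q _; rewrite /wform horner0 hornerC !expr0 mulr0 add0r !mulr1.
  by congr q; apply/val_inj.
- exists 1, 0 => q [_ q1]; rewrite /wform horner0 hornerC !expr0 mulr0 addr0 !mulr1 -q1.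
  by congr q; apply/val_inj.
- exists 1, 0 => q _; rewrite /wform horner0 hornerC !expr0 mulr0 addr0 expr1 !mulr1.
  by congr q; apply/val_inj.
- exists 1, 0 => q _; rewrite /wform horner0 hornerC !expr0 mulr0 addr0 expr1 mul1r mulr1.
  by congr q; apply/val_inj.
Qed.

Lemma odd_degM (p r : {poly k}) : p != 0 -> r != 0 ->
  odd (size (p * r)).-1 = odd (size p).-1 (+) odd (size r).-1.
Proof.
move=> p0 r0; rewrite size_mul //; move: p0 r0; rewrite -!size_poly_gt0.
by case: (size p) (size r) => [//|m] [//|n] _ _; rewrite addnS addSn /= oddD.
Qed.

Definition wnorm (t : weight) (A B : {poly k}) : {poly k} :=
  sqx2 ^+ t.1 * sqx3 ^+ t.2 * (A * A)
  - 'X * (sqx2 ^+ (~~ t.1) * sqx3 ^+ (~~ t.2) * (B * B)).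

(* The two summands of the norm have degrees of different parity. *)
Lemma wnorm_neq0 t A B : (A != 0) || (B != 0) -> wnorm t A B != 0.
Proof.
have [z2 z3] := size_sqx; case: t => c d AB; rewrite /wnorm /= subr_eq0.
have n2 : sqx2 != 0 by rewrite -size_poly_gt0 z2.
have n3 : sqx3 != 0 by rewrite -size_poly_gt0 z3.
have nX (b : bool) : sqx2 ^+ b != 0 by rewrite expf_neq0.
have nY (b : bool) : sqx3 ^+ b != 0 by rewrite expf_neq0.
have oX (b : bool) : odd (size (sqx2 ^+ b)).-1 = b.
  by case: b; rewrite ?expr0 ?expr1 ?z2 ?size_poly1.
have oY (b : bool) : odd (size (sqx3 ^+ b)).-1 = b.
  by case: b; rewrite ?expr0 ?expr1 ?z3 ?size_poly1.
case: (eqVneq A 0) AB => [->|nA].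
  by move=> /= nB; rewrite !mul0r !mulr0 eq_sym !mulf_eq0 (negbTE nB) polyX_eq0
    (negbTE (nX _)) (negbTE (nY _)).
case: (eqVneq B 0) => [->|nB] _.
  by rewrite !mul0r !mulr0 !mulf_eq0 (negbTE nA) (negbTE (nX _)) (negbTE (nY _)).
apply/eqP => /(congr1 (fun p : {poly k} => odd (size p).-1)).
rewrite !odd_degM ?mulf_neq0 ?polyX_eq0 // !oX !oY size_polyX !addbb !addbF.
by case: c; case: d.
Qed.

Lemma wform_eq0 t A B q : onEaff q -> wform t A B q = 0 -> (wnorm t A B).[q o0 * q o0] = 0.
Proof.
move=> qE /eqP; rewrite addr_eq0 => /eqP e.
have [e2 e3] := (sqx2E qE, sqx3E qE); rewrite /wnorm.
move: sqx2 sqx3 e2 e3 => P2 P3 e2 e3.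
rewrite !(hornerD, hornerN, hornerM, hornerX, horner_exp) e2 e3.
move: e; set u := _ * A.[_]; set v := _ * B.[_] => e.
rewrite [X in X - _](_ : _ = u * u); last first.
  by rewrite /u; case: (t.1); case: (t.2); rewrite /= ?(expr0, expr1); ring.
rewrite [X in _ - X](_ : _ = v * v); last first.
  by rewrite /v; case: (t.1); case: (t.2); rewrite /= ?(expr0, expr1); ring.
by rewrite e mulrNN subrr.
Qed.

Definition wfun_neq0 (f : ('I_4 -> k) -> k) : Prop :=
  (exists t, wfun t f) /\ exists2 q, onEaff q & f q != 0.

Lemma wform_neq0 t A B f : (A != 0) || (B != 0) ->
  (forall q, onEaff q -> f q = wform t A B q) -> wfun_neq0 f.
Proof.
move=> AB fE; split; first by exists t, A, B.
have /closed_nonrootP[x Nx] := wnorm_neq0 t AB.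
have [q qE qx] := onEaff_lift x; exists q => //.
by apply: contraNneq Nx; rewrite fE // => /(wform_eq0 qE); rewrite qx rootE => ->.
Qed.

Lemma wfun_norm f : wfun_neq0 f -> exists2 N : {poly k}, N != 0 &
  forall q, onEaff q -> f q = 0 -> N.[q o0 * q o0] = 0.
Proof.
case=> -[t [A [B fE]]] [q0 q0E fq0]; exists (wnorm t A B); last first.
  by move=> q qE; rewrite fE //; exact: wform_eq0.
apply: wnorm_neq0; apply: contraNT fq0; rewrite negb_or !negbK => /andP[/eqP A0 /eqP B0].
by rewrite fE // /wform A0 B0 !horner0 !mulr0 addr0.
Qed.

(** Zeros of each factor lie over roots of its norm. A value of x_0^2 that is a root of neither norm
    lifts to the curve because k is algebraically closed. *)
Lemma wfun_neq0M f g : wfun_neq0 f -> wfun_neq0 g -> wfun_neq0 (fun q => f q * g q).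
Proof.
move=> nf ng; have [[[s sf] _] [[t tg] _]] := (nf, ng).
split; first by exists (wadd s t); exact: wfunM.
have [[N N0 NE] [M M0 ME]] := (wfun_norm nf, wfun_norm ng).
have /closed_nonrootP[x] : N * M != 0 by rewrite mulf_neq0.
rewrite rootE hornerM mulf_eq0 negb_or => /andP[Nx Mx].
have [q qE qx] := onEaff_lift x; exists q => //.
rewrite mulf_neq0 //; apply/eqP.
  by move/(NE q qE); rewrite qx => /eqP; rewrite (negbTE Nx).
by move/(ME q qE); rewrite qx => /eqP; rewrite (negbTE Mx).
Qed.

End Functions.

(** * Chains of related points *)

Definition nx (i : 'I_4) : 'I_4 := nth o0 [:: o0; o2; o3; o1] i.

Lemma ord4P (P : 'I_4 -> Prop) : P o0 -> P o1 -> P o2 -> P o3 -> forall i, P i.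
Proof.
move=> h0 h1 h2 h3 [[|[|[|[|//]]]] iP].
- by rewrite (_ : Ordinal iP = o0) //; apply: val_inj.
- by rewrite (_ : Ordinal iP = o1) //; apply: val_inj.
- by rewrite (_ : Ordinal iP = o2) //; apply: val_inj.
- by rewrite (_ : Ordinal iP = o3) //; apply: val_inj.
Qed.

Section Chains.
Variables (k : closedFieldType) (a1 a2 a3 : k).
Hypothesis Ha : generic_alpha a1 a2 a3.
Local Notation pt := ('I_4 -> k).
Local Notation onEp := (onEp a1 a2 a3).
Local Notation onEaff := (onEaff a1 a2 a3).

Definition al (i : 'I_4) : k := [:: 0; a1; a2; a3]`_i.

(* The sum and the difference of the two relations attached to [i], with left *)
(* factors evaluated at [q] and right factors at [y].                         *)
Definition rel_form (b : bool) (i : 'I_4) (q y : pt) : k :=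
  if b then 2 * (q o0 * y i) - (1 + al i) * (q (nx i) * y (nx (nx i)))
            + (1 - al i) * (q (nx (nx i)) * y (nx i))
  else 2 * (q i * y o0) - (1 - al i) * (q (nx i) * y (nx (nx i)))
       + (1 + al i) * (q (nx (nx i)) * y (nx i)).

Definition omega_form (q y : pt) : k :=
  - (q o0 * y o0) + q o1 * y o1 + q o2 * y o2 + q o3 * y o3.
Definition omega_form' (q y : pt) : k :=
  (1 - a2) * (1 + a3) * (q o1 * y o1) + (1 + a1) * (1 + a3) * (q o2 * y o2)
  + (1 - a1) * (1 - a2) * (q o3 * y o3).

Definition related (q y : pt) : Prop :=
  [/\ forall b i, i != o0 -> rel_form b i q y = 0, omega_form q y = 0 & omega_form' q y = 0].

Definition nonzero_pt (q : pt) : Prop := exists u, q u != 0.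

(* Three quadratic expressions, without common zero on the curve, for one and *)
(* the same translation: in the case [l = 3], the last three coordinates are  *)
(* the vector product of the first two rows of the matrix of the relations    *)
(* [rel_form true], and the first one is read off [rel_form false 3].         *)
Definition step (l : 'I_4) (q : pt) : pt := fun u =>
  let i := nx l in let j := nx i in
  if u == o0 then 2 * (al i + al j) * (q i * q j) + (1 + al i) * (1 - al j) * (q o0 * q l)
  else if u == i then (1 - al i) * (1 - al j) * (q i * q l) + 2 * (1 + al i) * (q o0 * q j)
  else if u == j then (1 + al i) * (1 + al j) * (q j * q l) - 2 * (1 - al j) * (q o0 * q i)
  else 4 * (q o0 * q o0) + (1 - al i) * (1 + al j) * (q l * q l).

Lemma rel_form_kernel q y : (forall b i, i != o0 -> rel_form b i q y = 0) ->
  on_kernel a1 a2 a3 (q o0) (q o1) (q o2) (q o3) (y o0) (y o1) (y o2) (y o3).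
Proof.
move=> h; split; split.
- exact: (h true o1). - exact: (h false o1). - exact: (h true o2).
- exact: (h false o2). - exact: (h true o3). - exact: (h false o3).
Qed.

(** The case [l = 3] is the computation above; the other two follow by cyclic permutation of the
    parameters and coordinates. *)
Lemma step_related l q : l != o0 -> onEp q -> onEp (step l q) /\ related q (step l q).
Proof.
move=> l0 qE; have H1 := generic_cycle Ha; have E1 := onE_cycle Ha qE.
have H2 := generic_cycle H1; have E2 := onE_cycle H1 E1.
have E := generic_prod Ha; have [_ _ [n1 p1 m1] [n2 p2 m2] [n3 p3 m3]] := Ha.
have K (P : bool -> 'I_4 -> Prop) : P true o1 -> P false o1 -> P true o2 ->
    P false o2 -> P true o3 -> P false o3 -> forall b i, i != o0 -> P b i.
  by move=> ? ? ? ? ? ? b; apply: ord4P => //; case: b.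
move: l l0; apply: ord4P => // _.
- have [r1 r2 r3 r4] := step_rel12 H1 E1; have [r5 r6] := step_rel3 H1 E1.
  have [w w'] := step_omega H1 E1; split; last split.
  + exact: (onE_cycle H2 (onE_cycle H1 (step_onE H1 E1))).
  + by apply: K.
  + by rewrite -w /omega_form /step /al /nx /=; ring.
  (* The form [omega_form'] is cyclically invariant only up to a factor and [generic_prod], so both
     versions are first brought to a common multiple. *)
  + apply: (mulfI m3); rewrite mulr0 -[RHS](mulr0 (1 + a3)) -w'.
    apply/eqP; rewrite -subr_eq0; apply/eqP; set X := LHS.
    rewrite (_ : X = ((1 - a1) * (1 - a2) * (1 - a3) - (1 + a1) * (1 + a2) * (1 + a3))
        * (q o3 * step o1 q o3)).
      by rewrite E subrr mul0r.
    by rewrite /X /omega_form' /step /al /nx /=; ring.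
- have [r1 r2 r3 r4] := step_rel12 H2 E2; have [r5 r6] := step_rel3 H2 E2.
  have [w w'] := step_omega H2 E2; split; last split.
  + exact: (onE_cycle H2 (step_onE H2 E2)).
  + by apply: K.
  + by rewrite -w /omega_form /step /al /nx /=; ring.
  + apply: (mulfI p2); rewrite mulr0 -[RHS](mulr0 (1 - a2)) -w'.
    apply/eqP; rewrite -subr_eq0; apply/eqP; set X := LHS.
    rewrite (_ : X = ((1 - a1) * (1 - a2) * (1 - a3) - (1 + a1) * (1 + a2) * (1 + a3))
        * - (q o2 * step o2 q o2)).
      by rewrite E subrr mul0r.
    by rewrite /X /omega_form' /step /al /nx /=; ring.
have [r1 r2 r3 r4] := step_rel12 Ha qE; have [r5 r6] := step_rel3 Ha qE.
have [w w'] := step_omega Ha qE; split; last split.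
- exact: (step_onE Ha qE).
- by apply: K.
- by rewrite -w /omega_form /step /al /nx /=; ring.
- by rewrite -w' /omega_form' /step /al /nx /=; ring.
Qed.


Lemma onEp_neq0 q : onEp q -> nonzero_pt q -> q o0 != 0 \/ q o1 != 0.
Proof.
move=> qE [u qu]; case: (eqVneq (q o0) 0) => [h0|]; last by left.
case: (eqVneq (q o1) 0) => [h1|]; last by right.
have [h2 h3] := onE_01 Ha qE h0 h1; move: u qu.
by apply: ord4P; rewrite ?h0 ?h1 ?h2 ?h3 eqxx.
Qed.

Lemma rel_form_line q y x : onEp q -> nonzero_pt q ->
  (forall b i, i != o0 -> rel_form b i q y = 0) -> (forall b i, i != o0 -> rel_form b i q x = 0) ->
  forall u v, y u * x v = y v * x u.
Proof.
move=> qE qn /rel_form_kernel ry /rel_form_kernel rx.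
have [[e12 e13 e23] [e01 e02 e03]] := kernel_line Ha qE (onEp_neq0 qE qn) ry rx.
by apply: ord4P; apply: ord4P;
   rewrite ?e12 ?e13 ?e23 ?e01 ?e02 ?e03 // mulrC ?e12 ?e13 ?e23 -?e01 -?e02 -?e03 // mulrC.
Qed.

Lemma related_line q y x : onEp q -> nonzero_pt q -> related q y -> related q x ->
  forall u v, y u * x v = y v * x u.
Proof. by move=> qE qn [ry _ _] [rx _ _]; apply: rel_form_line ry rx. Qed.

Lemma related_scale q y x : onEp q -> nonzero_pt q -> related q y -> related q x -> nonzero_pt x ->
  exists c, forall u, y u = c * x u.
Proof.
move=> qE qn ry rx [v xv]; exists (y v / x v) => u.
by rewrite mulrAC -(related_line qE qn ry rx) mulfK.
Qed.

(** Coordinate [l] of [step l q] is a minor of [onE_minor]; on [q o0 = 0] that for [l = 3] reduces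
    to a nonzero multiple of the square of [q o3]. *)
Lemma step_nonzero_pt q : onEp q -> nonzero_pt q -> exists2 l, l != o0 & nonzero_pt (step l q).
Proof.
move=> qE qn; case: (eqVneq (q o0) 0) => [h0|n0].
  have n1 : q o1 != 0 by case: (onEp_neq0 qE qn) => //; rewrite h0 eqxx.
  have [n2 n3] := onE_neq23 Ha qE h0 n1.
  case: Ha => _ _ [_ _ m1] [_ p2 _] _; exists o3 => //; exists o3.
  by rewrite /step /= h0 mul0r mulr0 add0r !mulf_neq0.
by case: (onE_minor Ha qE n0) => d; [exists o1|exists o2|exists o3] => //;
   [exists o1|exists o2|exists o3].
Qed.

Definition chain (c : nat -> pt) : Prop :=
  forall i, [/\ onEp (c i), nonzero_pt (c i) & related (c i) (c i.+1)].

Lemma chain_exists q : onEp q -> nonzero_pt q -> exists2 c, chain c & c 0%N = q.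
Proof.
move=> qE qn.
have nextP (y : {y : pt | onEp y /\ nonzero_pt y}) :
    {z : {z : pt | onEp z /\ nonzero_pt z} | related (sval y) (sval z)}.
  case: y => y [yE yn]; apply: cid.
  have [l l0 ln] := step_nonzero_pt yE yn; have [lE lr] := step_related l0 yE.
  by exists (exist _ (step l y) (conj lE ln)).
pose F y := sval (nextP y); pose y0 := exist (fun y => onEp y /\ nonzero_pt y) q (conj qE qn).
exists (fun i => sval (iter i F y0)) => // i.
by have [iE iN] := svalP (iter i F y0); split=> //; exact: (svalP (nextP _)).
Qed.

Lemma onEp_scale c q : onEp q -> onEp (fun u => c * q u).
Proof.
case=> g1 g3; split.
  by rewrite -[RHS](mulr0 (c * c)) -g1; ring.
by rewrite -[RHS](mulr0 (c * c)) -g3; ring.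
Qed.

Lemma related_scalel c q y : related q y -> related (fun u => c * q u) y.
Proof.
case=> r w w'; split.
- move=> b i i0; rewrite -[RHS](mulr0 c) -(r b i i0) /rel_form; case: b; ring.
- by rewrite -[RHS](mulr0 c) -w /omega_form; ring.
- by rewrite -[RHS](mulr0 c) -w' /omega_form'; ring.
Qed.

Lemma step_scale l c q u : step l (fun v => c * q v) u = c * c * step l q u.
Proof. by rewrite /step; do 3?case: ifP => _; ring. Qed.

(* Negating [x_0] exchanges the relations with their transposes. *)
Definition neg0 (q : pt) : pt := fun u => if u == o0 then - q u else q u.

Lemma neg0K q : neg0 (neg0 q) =1 q.
Proof. by move=> u; rewrite /neg0; case: (u == o0); rewrite ?opprK. Qed.

Lemma onEp_neg0 q : onEp q -> onEp (neg0 q).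
Proof. by case=> g1 g3; split; rewrite /neg0 /= ?mulrNN. Qed.

Lemma related_neg0 q y : related q y -> related (neg0 y) (neg0 q).
Proof.
case=> r w w'; split.
- move=> b i i0; rewrite -[RHS]oppr0 -(r (~~ b) i i0) /rel_form /neg0 /=.
  move: i i0; apply: ord4P => // _; case: b => /=; ring.
- by rewrite -w /omega_form /neg0 /=; ring.
- by rewrite -w' /omega_form' /neg0 /=; ring.
Qed.

End Chains.

(** * Evaluation of words along chains *)

Lemma waddA : associative wadd.
Proof. by move=> [? ?] [? ?] [? ?]; rewrite /wadd /= !addbA. Qed.
Lemma waddC : commutative wadd.
Proof. by move=> [a b] [c d]; rewrite /wadd /= (addbC a) (addbC b). Qed.
Lemma wadd0 : left_id (false, false) wadd.
Proof. by move=> [? ?]. Qed.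
Lemma waddAACK t x y : wadd (wadd t x) (wadd t y) = wadd x y.
Proof. by case: t x y => [[] []] [[] []] [[] []]. Qed.
Lemma waddrK t s : wadd (wadd s t) t = s.
Proof. by case: s t => [[] []] [[] []]. Qed.
Lemma waddACA : interchange wadd wadd.
Proof. by move=> [[] []] [[] []] [[] []] [[] []]. Qed.

Definition wsum (w : seq 'I_4) : weight := foldr (fun j => wadd (wgen j)) (false, false) w.

Lemma wsum_rcons w j : wsum (rcons w j) = wadd (wsum w) (wgen j).
Proof.
elim: w => [|i w IH] /=; first by rewrite waddC.
by rewrite IH waddA.
Qed.

Section Values.
Variables (k : closedFieldType) (a1 a2 a3 : k).
Hypothesis Ha : generic_alpha a1 a2 a3.
Local Notation pt := ('I_4 -> k).
Local Notation onEp := (onEp a1 a2 a3).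
Local Notation onEaff := (onEaff a1 a2 a3).
Local Notation chain := (chain a1 a2 a3).
Local Notation wfun := (wfun a1 a2 a3).
Local Notation wfun_neq0 := (wfun_neq0 a1 a2 a3).
Local Notation step := (step a1 a2 a3).

Fixpoint eval_word (c : nat -> pt) (s : nat) (w : seq 'I_4) : k :=
  if w is j :: w' then c s j * eval_word c s.+1 w' else 1.

Definition eval_comb (c : nat -> pt) (s : nat) (L : seq (k * seq 'I_4)) : k :=
  \sum_(t <- L) t.1 * eval_word c s t.2.

Definition homog (n : nat) (x : weight) (L : seq (k * seq 'I_4)) : bool :=
  all (fun t => (size t.2 == n) && (wsum t.2 == x)) L.

Lemma eval_word_scale (c d : nat -> pt) (l : nat -> k) s w :
  (forall i u, d i u = l i * c i u) ->
  eval_word d s w = (\prod_(i < size w) l (s + i)%N) * eval_word c s w.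
Proof.
move=> dE; elim: w s => [|j w IH] s /=; first by rewrite big_ord0 mul1r.
rewrite IH dE big_ord_recl /= addn0.
rewrite [in RHS](eq_bigr (fun i : 'I_(size w) => l (s.+1 + i)%N)); last first.
  by move=> i _; congr l; rewrite addSnnS.
by move: (\prod_(_ < _) _) (eval_word _ _ _) => x y; ring.
Qed.

Lemma eval_word_rcons c s w j : eval_word c s (rcons w j) = eval_word c s w * c (s + size w)%N j.
Proof.
elim: w s => [|i w IH] s /=; first by rewrite mulr1 mul1r addn0.
by rewrite IH mulrA addSnnS.
Qed.

Lemma eval_word_shift c s w : eval_word (fun i => c i.+1) s w = eval_word c s.+1 w.
Proof. by elim: w s => //= j w IH s; rewrite IH. Qed.

Lemma eval_comb_shift c s L : eval_comb (fun i => c i.+1) s L = eval_comb c s.+1 L.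
Proof. by apply: eq_bigr => t _; rewrite eval_word_shift. Qed.

Lemma eval_comb_scale n x L (c d : nat -> pt) (l : nat -> k) s : homog n x L ->
  (forall i u, d i u = l i * c i u) ->
  eval_comb d s L = (\prod_(i < n) l (s + i)%N) * eval_comb c s L.
Proof.
move=> /allP hL dE; rewrite /eval_comb mulr_sumr big_seq [RHS]big_seq.
apply: eq_bigr => t /hL /andP[/eqP <- _].
by rewrite (eval_word_scale _ _ dE); ring.
Qed.

Section Family.
Variable sel : nat -> 'I_4.
Hypothesis sel0 : forall i, sel i != o0.

Fixpoint step_iter (i : nat) (q : pt) : pt :=
  if i is i'.+1 then step (sel i') (step_iter i' q) else q.

(** The starting point is normalised by [x_1 = 1], whence [(true, true)]. A later point keeps only
    the weight of its last step: [step] is quadratic and weights have order two, so the earlier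
    shift cancels. *)
Definition step_iter_weight (i : nat) : weight :=
  if i is i'.+1 then wgen (sel i') else (true, true).

Lemma step_wfun l t (X : pt -> pt) : l != o0 ->
  (forall u, wfun (wadd t (wgen u)) (fun q => X q u)) ->
  forall u, wfun (wadd (wgen l) (wgen u)) (fun q => step l (X q) u).
Proof.
move=> l0 hX.
have M u v w : wadd (wgen u) (wgen v) = w -> wfun w (fun q => X q u * X q v).
  move=> <-; have := wfunM Ha (hX u) (hX v).
  by rewrite waddAACK.
have N w f : wfun w f -> wfun w (fun q => - f q).
  case=> [A [B fE]]; exists (- A), (- B) => q qE.
  by rewrite fE // /wform !hornerN; ring.
by move: l l0; apply: ord4P => // _; apply: ord4P; rewrite /step /=;
  apply: wfunD; do ?apply: N; apply: wfunZ; apply: M.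
Qed.

Lemma step_iter_wfun i u : wfun (wadd (step_iter_weight i) (wgen u)) (fun q => step_iter i q u).
Proof.
elim: i u => [|i IH] u /=; first exact: wfun_coord.
exact: (step_wfun (sel0 i) IH).
Qed.

Lemma eval_word_wfun s w : exists2 t, wfun t (fun q => eval_word (fun i => step_iter i q) s w)
  & t = wadd (\big[wadd/(false, false)]_(i < size w) step_iter_weight (s + i)%N) (wsum w).
Proof.
elim: w s => [|j w IH] s /=.
  by exists (false, false); [exact: wfun1|rewrite big_ord0].
have [t ht tE] := IH s.+1.
exists (wadd (wadd (step_iter_weight s) (wgen j)) t); first by apply: wfunM => //;
  apply: step_iter_wfun.
rewrite tE big_ord_recl addn0 waddACA; congr (wadd (wadd _ _) _).
by apply: eq_bigr => i _; congr step_iter_weight; rewrite addSnnS.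
Qed.

Lemma eval_comb_wfun n x L s : homog n x L -> exists t,
  wfun t (fun q => eval_comb (fun i => step_iter i q) s L).
Proof.
move=> hL; exists (wadd (\big[wadd/(false, false)]_(i < n) step_iter_weight (s + i)%N) x).
elim: L hL => [|[c w] L IH] /=.
  by move=> _; have [A [B h]] := wfun0 a1 a2 a3 (wadd (\big[wadd/(false,
    false)]_(i < n) step_iter_weight (s + i)%N) x);
   exists A, B => q qE; rewrite /eval_comb big_nil; exact: h.
case/andP=> /andP[/eqP sw /eqP xw] /IH[A [B h]].
have [t [C [D h']] tE] := eval_word_wfun s w; rewrite sw xw in tE; rewrite -tE.
rewrite -tE in h.
have [P [Q h'']] : wfun t (fun q => c * eval_word (fun i => step_iter i q) s w + eval_comb (fun
  i => step_iter i q) s L).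
  by apply: wfunD; [apply: wfunZ; exists C, D|exists A, B].
by exists P, Q => q qE; rewrite -h'' // /eval_comb big_cons.
Qed.

(** Any chain agrees up to scalars with the algebraic family that starts at the same point, by
    uniqueness of the next point. This turns values along chains into functions on the curve. *)
Lemma step_iter_chain (c : nat -> pt) : chain c -> exists l : nat -> k,
  (forall i u, step_iter i (c 0%N) u = l i * c i u) /\
  ((forall i, nonzero_pt (step (sel i) (c i))) -> forall i, l i != 0).
Proof.
move=> hc.
have mP i : {m : k | forall u, step (sel i) (c i) u = m * c i.+1 u}.
  have [cE cn cr] := hc i; have [_ cn' _] := hc i.+1.
  exact: cid (related_scale Ha cE cn (step_related Ha (sel0 i) cE).2 cr cn').
(* The previous scalar enters squared because [step] is quadratic. *)
pose l := fix l i := if i is i'.+1 then l i' * l i' * sval (mP i') else 1.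
exists l; split=> [i|hn i].
  elim: i => [|i IH] u /=; first by rewrite mul1r.
  have -> : step_iter i (c 0%N) = fun u => l i * c i u by apply/funext.
  by rewrite step_scale (svalP (mP i)) mulrA.
elim: i => [|i IH]; first exact: oner_neq0.
rewrite /= !mulf_neq0 //; have [u] := hn i.
by rewrite (svalP (mP i)) mulf_eq0 negb_or => /andP[].
Qed.

End Family.

Definition nonvanishing (s : nat) (L : seq (k * seq 'I_4)) : Prop :=
  exists c, [/\ chain c, onEaff (c 0%N) & eval_comb c s L != 0].

(* If [L] does not vanish along [c], choose at each point of [c] a quadratic *)
(* expression for the translation that is nonzero there.                      *)
Lemma nonvanishing_generic n x L s : homog n x L -> nonvanishing s L ->
  exists2 f, wfun_neq0 f &
    forall c, chain c -> onEaff (c 0%N) -> f (c 0%N) != 0 -> eval_comb c s L != 0.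
Proof.
move=> hL [c [hc cE cL]].
have selP i : {l | l != o0 /\ nonzero_pt (step l (c i))}.
  apply: cid; have [? ? _] := hc i.
  by have [l ? ?] := step_nonzero_pt Ha (q := c i) ltac:(by []) ltac:(by []); exists l.
pose sel i := sval (selP i).
have sel0 i : sel i != o0 by have [] := svalP (selP i).
exists (fun q => eval_comb (fun i => step_iter sel i q) s L).
  split; first exact: eval_comb_wfun hL.
  exists (c 0%N) => //; have [l [lE ln]] := step_iter_chain sel0 hc.
  rewrite (eval_comb_scale _ hL lE) mulf_neq0 //.
  apply/prodf_neq0 => i _; apply: ln => j; by have [] := svalP (selP j).
move=> c' hc' cE'; have [l [lE _]] := step_iter_chain sel0 hc'.
by rewrite (eval_comb_scale _ hL lE) mulf_eq0 negb_or => /andP[].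
Qed.

(** Since [neg0] reverses the relation between consecutive points, conjugating a step by [neg0]
    gives the backward translation, here normalised to [x_1 = 1]. *)
Definition pred_pt (q : pt) : pt := fun u =>
  (step o3 (neg0 q) o1)^-1 * neg0 (step o3 (neg0 q)) u.

Lemma pred_ptP q : onEaff q -> step o3 (neg0 q) o1 != 0 ->
  onEaff (pred_pt q) /\ related a1 a2 a3 (pred_pt q) q.
Proof.
move=> [qE q1] n1; have [sE sr] := step_related Ha (isT : o3 != o0) (onEp_neg0 qE).
split; first split.
- exact: onEp_scale (onEp_neg0 sE).
- by rewrite /pred_pt /neg0 /= mulVf.
apply: related_scalel; have := related_neg0 sr.
by rewrite (_ : neg0 (neg0 q) = q) //; apply/funext; apply: neg0K.
Qed.

Lemma pred_pt_generic :
  wfun_neq0 (fun q => step o3 (neg0 q) o1) /\ wfun_neq0 (fun q => step o3 (neg0 q) o0).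
Proof.
have s := generic_add_neq0 Ha; have [n2 _ [_ p1 m1] [_ p2 m2] _] := Ha; split.
- apply: (@wform_neq0 _ _ _ _ Ha (false, true)
    ((1 - a1) * (1 - a2))%:P (- 2 * (1 + a1))%:P).
    by rewrite polyC_eq0 !mulf_neq0.
  move=> q [_ q1]; rewrite /wform /step /neg0 /= !hornerC !expr0 !expr1 /al /nx /= q1; ring.
apply: (@wform_neq0 _ _ _ _ Ha (true, false)
    (2 * (a1 + a2))%:P (- ((1 + a1) * (1 - a2)))%:P).
  by rewrite polyC_eq0 !mulf_neq0.
move=> q [_ q1]; rewrite /wform /step /neg0 /= !hornerC !expr0 !expr1 /al /nx /= q1; ring.
Qed.

(** A generic chain is prolonged to the left by a predecessor of its starting point. Genericity also
    makes coordinate 0 of the predecessor nonzero, as needed for cancelling x_0 in [wcomb_eq0]. *)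
Lemma nonvanishing_succ n x L s : homog n x L -> nonvanishing s L ->
  exists c, [/\ chain c, onEaff (c 0%N), c 0%N o0 != 0 & eval_comb c s.+1 L != 0].
Proof.
move=> hL /(nonvanishing_generic hL)[f f0 fP]; have [g1 g0] := pred_pt_generic.
have [_ [q qE]] := wfun_neq0M Ha f0 (wfun_neq0M Ha g1 g0).
rewrite !mulf_eq0 !negb_or => /andP[fq /andP[h1 h0]].
have qn : nonzero_pt q by exists o1; rewrite qE.2 oner_neq0.
have [c hc c0] := chain_exists Ha qE.1 qn.
have [pE pr] := pred_ptP qE h1.
pose d i := if i is i'.+1 then c i' else pred_pt q.
exists d; split=> //.
- case=> [|i]; last exact: hc.
  split; [exact: pE.1| |by rewrite /= c0].
  by exists o1; apply/eqP => /eqP; rewrite -[d 0%N o1]/(pred_pt q o1) pE.2 oner_eq0.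
- rewrite /d /pred_pt; apply: mulf_neq0; first by rewrite invr_eq0.
  by rewrite {1}/neg0 eqxx oppr_eq0.
- by rewrite -eval_comb_shift; move: (fP c hc); rewrite c0; apply.
Qed.

Lemma nonvanishing_shift n x L s : homog n x L -> nonvanishing s L -> nonvanishing s.+1 L.
Proof. by move=> hL /(nonvanishing_succ hL)[c [? ? _ ?]]; exists c. Qed.

End Values.

(** * Words in B and truncated point modules *)

Section Words.
Variables (k : fieldType) (A : algType k) (x : 'I_4 -> A).
Definition wprod (w : seq 'I_4) : A := \prod_(j <- w) x j.
Definition wcomb (L : seq (k * seq 'I_4)) : A := \sum_(t <- L) t.1 *: wprod t.2.

Lemma wprod_rcons w j : wprod (rcons w j) = wprod w * x j.
Proof. by rewrite /wprod -cats1 big_cat big_seq1. Qed.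
End Words.

Section Algebra.
Variables (k : closedFieldType) (a1 a2 a3 : k).
Hypothesis Ha : generic_alpha a1 a2 a3.
Local Notation pt := ('I_4 -> k).
Local Notation chain := (chain a1 a2 a3).
Local Notation al := (al a1 a2 a3).
Local Notation B := (sklB a1 a2 a3).
Local Notation x := (xB a1 a2 a3).

(** The products are abstracted to [f], so that the same relations serve for elements of B, for
    scalars and for mixed products [q u *: z v]. *)
Definition rel_elt (V : lmodType k) (b : bool) (i : 'I_4) (f : 'I_4 -> 'I_4 -> V) : V :=
  if b then 2 *: f o0 i - (1 + al i) *: f (nx i) (nx (nx i))
            + (1 - al i) *: f (nx (nx i)) (nx i)
  else 2 *: f i o0 - (1 - al i) *: f (nx i) (nx (nx i))
       + (1 + al i) *: f (nx (nx i)) (nx i).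

Lemma rel_elt_comm_anti (A : algType k) (y : 'I_4 -> A) i :
  rel_elt true i (fun u v => y u * y v)
    = rel_anti y i (nx i) (nx (nx i)) + rel_comm y (al i) i (nx i) (nx (nx i)) /\
  rel_elt false i (fun u v => y u * y v)
    = rel_anti y i (nx i) (nx (nx i)) - rel_comm y (al i) i (nx i) (nx (nx i)).
Proof.
rewrite /rel_elt /rel_comm /rel_anti.
move: (y o0 * y i) (y i * y o0) => u v.
move: (y (nx i) * _) (y (nx (nx i)) * _) (al i) => s t a.
rewrite !scalerDl !scaleNr !scale1r !scalerDr !opprD !opprK; split.
  rewrite [RHS](AC ((2*2)*(2*2)) (((1*5)*(3*7))*(4*8)*(2*6))) /=.
  by rewrite subrr addr0.
rewrite [RHS](AC ((2*2)*(2*2)) (((2*6)*(3*7))*(4*8)*(1*5))) /=.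
by rewrite subrr addr0.
Qed.

Lemma sklB_rels s : s \in sklyanin_rels x a1 a2 a3 -> s = 0.
Proof.
have -> : x = qproj (Brels_proper a1 a2 a3) \o xQ a1 a2 a3 by [].
by rewrite -sklyanin_rels_morph => /mapP[t /xQ_rels -> ->]; rewrite raddf0.
Qed.

Lemma sklB_omega : omega x = 0 /\ omega' x a1 a2 a3 = 0.
Proof.
have -> : x = qproj (Brels_proper a1 a2 a3) \o xQ a1 a2 a3 by [].
rewrite -omega_morph -omega'_morph.
by split; apply/eqP; rewrite qproj_eq0 tsideal_gen // /Brels !inE eqxx ?orbT.
Qed.

Section Eval.
Variables (c : nat -> pt) (N : nat).

(** A weighted shift on N+1 basis vectors. In the resulting representation, entry (s, t) reads the
    component of degree t - s along the chain from place s on. *)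
Definition chain_mx (j : 'I_4) : 'M[k]_N.+1 :=
  \matrix_(s, t) (if t == s.+1 :> nat then c s j else 0).

Lemma chain_mx_mul j (M : 'M[k]_N.+1) (s t : 'I_N.+1) :
  (chain_mx j * M) s t = if (s < N)%N then c s j * M (inord s.+1) t else 0.
Proof.
rewrite !mxE; case: ltnP => sN; last first.
  rewrite big1 // => r _; rewrite !mxE ltn_eqF ?mul0r //.
  by rewrite ltnS (leq_trans _ sN) // -ltnS.
rewrite (bigD1 (inord s.+1)) //= big1 ?addr0 => [|r rs].
  by rewrite !mxE inordK // eqxx.
rewrite !mxE; case: eqP => [e|_]; last by rewrite mul0r.
by case/eqP: rs; apply: val_inj; rewrite /= inordK.
Qed.

Lemma chain_mxM i j : chain_mx i * chain_mx j =
  \matrix_(s, t) (if t == s.+2 :> nat then c s i * c s.+1 j else 0).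
Proof.
apply/matrixP => s t; rewrite chain_mx_mul !mxE; case: ltnP => sN.
  by rewrite inordK //; case: ifP => // _; rewrite mulr0.
have -> // : (t == s.+2 :> nat) = false.
by apply/ltn_eqF; rewrite ltnS (leq_trans _ (leqW sN)) // -ltnS.
Qed.

Lemma ev_wprod (A : algType k) (y : 'I_4 -> A) (e : {lrmorphism A -> 'M[k]_N.+1})
    w (s t : 'I_N.+1) : (forall j, e (y j) = chain_mx j) ->
  e (wprod y w) s t = if t == (s + size w)%N :> nat then eval_word c s w else 0.
Proof.
move=> he; elim: w s => [|j w IH] s; rewrite /wprod.
  by rewrite big_nil rmorph1 mxE addn0 /= -mulrb -val_eqE eq_sym.
rewrite big_cons rmorphM /= he chain_mx_mul IH; case: ltnP => sN.
  by rewrite inordK // addnS addSn; case: ifP => // _; rewrite mulr0.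
have -> // : (t == s + (size w).+1 :> nat)%N = false.
rewrite addnS; apply/ltn_eqF; rewrite ltnS.
by rewrite (leq_trans _ (leq_trans sN (leq_addr _ _))) // -ltnS.
Qed.

Lemma ev_wcomb (A : algType k) (y : 'I_4 -> A) (e : {lrmorphism A -> 'M[k]_N.+1})
    n z L (s t : 'I_N.+1) : (forall j, e (y j) = chain_mx j) -> homog n z L ->
  e (wcomb y L) s t = if t == (s + n)%N :> nat then eval_comb c s L else 0.
Proof.
move=> he /allP hL; rewrite /wcomb linear_sum summxE /eval_comb.
case: ifP => te; rewrite big_seq; last first.
  rewrite big1 // => u /hL/andP[/eqP su _].
  by rewrite linearZ mxE (ev_wprod _ _ _ he) su te mulr0.
rewrite [RHS]big_seq; apply: eq_bigr => u /hL/andP[/eqP su _].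
by rewrite linearZ mxE (ev_wprod _ _ _ he) su te.
Qed.

Hypothesis hc : chain c.

Lemma chain_mx_rels :
  [/\ forall s, s \in sklyanin_rels chain_mx a1 a2 a3 -> s = 0, omega chain_mx = 0
    & omega' chain_mx a1 a2 a3 = 0].
Proof.
have [n2 _ [n1 p1 m1] [n2' p2 m2] [n3 p3 m3]] := Ha.
have R i s : i != o0 ->
   c s o0 * c s.+1 i - c s i * c s.+1 o0 - al i * (c s (nx i) * c s.+1 (nx (nx i)) + c s (nx
     (nx i)) * c s.+1 (nx i)) = 0
   /\ c s o0 * c s.+1 i + c s i * c s.+1 o0 - (c s (nx i) * c s.+1 (nx (nx i)) - c s (nx (nx
     i)) * c s.+1 (nx i)) = 0.
  move=> i0; have [_ _ [r _ _]] := hc s; have hA := r true i i0; have hC := r false i i0.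
  split; apply: (mulfI n2); rewrite mulr0.
    by rewrite -[RHS](subrr 0) -{1}hA -hC /rel_form; ring.
  by rewrite -[RHS](addr0 0) -{1}hA -hC /rel_form; ring.
have C i : i != o0 -> rel_comm chain_mx (al i) i (nx i) (nx (nx i)) = 0
    /\ rel_anti chain_mx i (nx i) (nx (nx i)) = 0.
  move=> i0; rewrite /rel_comm /rel_anti !chain_mxM; split; apply/matrixP => s t;
    have [r1 r2] := R i s i0; rewrite !mxE; case: ifP => _ //;
    by rewrite !(addr0, subrr, mulr0).
split.
- move=> s; rewrite /sklyanin_rels !inE.
  have [-> ->] := C o1 isT; have [-> ->] := C o2 isT; have [-> ->] := C o3 isT.
  by rewrite !orbb => /eqP.
- rewrite /omega !expr2 !chain_mxM; apply/matrixP => s t; rewrite !mxE.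
  have [_ _ [_ w _]] := hc s; case: ifP => _; last by rewrite !(addr0, oppr0).
  exact: w.
rewrite /omega' !expr2 !chain_mxM; apply/matrixP => s t; rewrite !mxE.
have [_ _ [_ _ w]] := hc s; case: ifP => _; last by rewrite !(addr0, mulr0).
apply: (mulfI (mulf_neq0 m2 p3)); rewrite mulr0 -w /omega_form'.
by field; rewrite m2 p3.
Qed.


Fact evQ_rels s : s \in Qrels a1 a2 a3 -> fsubst chain_mx s = 0.
Proof. by apply: fsubst_Qrels; case: chain_mx_rels. Qed.

Definition evQ := qlift (Qrels_proper a1 a2 a3) evQ_rels.
HB.instance Definition _ := GRing.LRMorphism.on evQ.

Lemma evQ_gen j : evQ (xQ a1 a2 a3 j) = chain_mx j.
Proof. by rewrite /evQ /xQ qliftE; exact: fsubst_gen. Qed.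

Fact evB_rels s : s \in Brels a1 a2 a3 -> evQ s = 0.
Proof.
have E : evQ \o xQ a1 a2 a3 = chain_mx by apply/funext => j; exact: evQ_gen.
have [_ w w'] := chain_mx_rels.
by rewrite !inE => /orP[] /eqP->; rewrite (omega_morph, omega'_morph) E.
Qed.

Definition evB := qlift (Brels_proper a1 a2 a3) evB_rels.
HB.instance Definition _ := GRing.LRMorphism.on evB.

Lemma evB_gen j : evB (x j) = chain_mx j.
Proof. by rewrite /evB /xB qliftE; exact: evQ_gen. Qed.

End Eval.

Lemma sklB_span b : exists L, b = wcomb x L.
Proof.
rewrite -(qreprK b) -(qreprK (qrepr b)).
set f := qrepr (qrepr b).
exists [seq (mcoeff m f, (m : seq 'I_4)) | m <- msupp f].
rewrite /wcomb big_map {1}(monalgE f) !raddf_sum; apply: eq_bigr => m _ /=.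
rewrite (@fgen_word k 4) !linearZ; congr (_ *: _).
by rewrite /word_eval !rmorph_prod.
Qed.

End Algebra.

(** * Linear algebra of the quadratic relations *)

Lemma wgen_nx i : i != o0 -> wadd (wgen (nx i)) (wgen (nx (nx i))) = wgen i.
Proof. by move: i; apply: ord4P. Qed.

Lemma wgen_onto (t : weight) : exists j, wgen j = t.
Proof. by case: t => [[] []]; [exists o1|exists o3|exists o2|exists o0]. Qed.

Lemma big_ord4 (V : nmodType) (F : 'I_4 -> V) :
  \sum_i F i = F o0 + F o1 + F o2 + F o3.
Proof.
rewrite !big_ord_recl big_ord0 addr0 !addrA.
by congr (_ + _ + _ + _); congr F; apply: val_inj.
Qed.

Section Lin4.
Variables (k : fieldType) (V : lmodType k) (u v s t : V).
(** Recording coefficients reduces identities between module elements to identities between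
    scalars. *)
Definition lin4 (c d e f : k) : V := c *: u + d *: v + e *: s + f *: t.
Lemma lin4D c d e f c' d' e' f' :
  lin4 c d e f + lin4 c' d' e' f' = lin4 (c + c') (d + d') (e + e') (f + f').
Proof.
by rewrite /lin4 !scalerDl [LHS](AC (4*4) ((1*5)*(2*6)*(3*7)*(4*8))).
Qed.
Lemma lin4Z a c d e f : a *: lin4 c d e f = lin4 (a * c) (a * d) (a * e) (a * f).
Proof. by rewrite /lin4 !scalerDr !scalerA. Qed.
End Lin4.

Section Spanning.
Variables (k : closedFieldType) (a1 a2 a3 : k).
Hypothesis Ha : generic_alpha a1 a2 a3.
Local Notation pt := ('I_4 -> k).
Local Notation chain := (chain a1 a2 a3).
Local Notation al := (al a1 a2 a3).
Local Notation rel_form := (rel_form a1 a2 a3).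
Local Notation rel_elt := (rel_elt a1 a2 a3).
Local Notation B := (sklB a1 a2 a3).
Local Notation x := (xB a1 a2 a3).

Lemma rel_elt_lin4 (V : lmodType k) i (f : 'I_4 -> 'I_4 -> V) :
  rel_elt true i f = lin4 (f o0 i) (f i o0) (f (nx i) (nx (nx i))) (f (nx (nx i)) (nx i))
                    2 0 (- (1 + al i)) (1 - al i) /\
  rel_elt false i f = lin4 (f o0 i) (f i o0) (f (nx i) (nx (nx i))) (f (nx (nx i)) (nx i))
                    0 2 (- (1 - al i)) (1 + al i).
Proof. by rewrite /rel_elt /lin4 !scale0r !addr0 !add0r !scaleNr. Qed.

Lemma al_neq0 i : i != o0 -> [/\ al i != 0, 1 + al i != 0 & 1 - al i != 0].
Proof. by case: Ha => _ _ ? ? ?; move: i; apply: ord4P. Qed.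

(** As alpha_i is nonzero, the two relations of index i can be solved for x_j x_l and x_l x_j in
    terms of x_0 x_i and x_i x_0. *)
Lemma rel_elt_solve (V : lmodType k) i (f : 'I_4 -> 'I_4 -> V) :
  (forall b, rel_elt b i f = 0) ->
  - (1 + al i) *: f o0 i + (1 - al i) *: f i o0
    + (2 * al i) *: f (nx i) (nx (nx i)) = 0 /\
  - (1 - al i) *: f o0 i + (1 + al i) *: f i o0
    + (2 * al i) *: f (nx (nx i)) (nx i) = 0.
Proof.
move=> h; have [hA hC] := rel_elt_lin4 i f; have n2 : 2 != 0 :> k by case: Ha.
move: hA hC; rewrite !h => /esym hA /esym hC.
split; apply: (scalerI n2); rewrite scaler0.
  transitivity (lin4 (f o0 i) (f i o0) (f (nx i) (nx (nx i))) (f (nx (nx i)) (nx i))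
    (2 * (- (1 + al i))) (2 * (1 - al i)) (2 * (2 * al i)) (2 * 0)).
    by rewrite -lin4Z /lin4 scale0r addr0.
  transitivity ((- (1 + al i)) *: 0 + (1 - al i) *: (0 : V)); last by rewrite !scaler0 addr0.
  by rewrite -{1}hA -hC !lin4Z lin4D; congr lin4; ring.
transitivity (lin4 (f o0 i) (f i o0) (f (nx i) (nx (nx i))) (f (nx (nx i)) (nx i))
    (2 * (- (1 - al i))) (2 * (1 + al i)) (2 * 0) (2 * (2 * al i))).
  by rewrite -lin4Z /lin4 scale0r addr0.
transitivity ((- (1 - al i)) *: 0 + (1 + al i) *: (0 : V)); last by rewrite !scaler0 addr0.
by rewrite -{1}hA -hC !lin4Z lin4D; congr lin4; ring.
Qed.

Lemma rel_elt_sklB b i : i != o0 -> rel_elt b i (fun u v => x u * x v) = 0.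
Proof.
move=> i0; have [hA hC] := rel_elt_comm_anti a1 a2 a3 x i.
have H n : (n < 6)%N -> nth 0 (sklyanin_rels x a1 a2 a3) n = 0.
  by move=> n6; apply: sklB_rels; apply: mem_nth.
have rC : rel_comm x (al i) i (nx i) (nx (nx i)) = 0.
  by move: i i0 {hA hC}; apply: ord4P => // _;
    [exact: (H 0%N)|exact: (H 1%N)|exact: (H 2%N)].
have rA : rel_anti x i (nx i) (nx (nx i)) = 0.
  by move: i i0 {hA hC rC}; apply: ord4P => // _;
    [exact: (H 3%N)|exact: (H 4%N)|exact: (H 5%N)].
by case: b; rewrite ?hA ?hC rC rA ?addr0 ?subr0.
Qed.

Lemma rel_elt_closed (V : lmodType k) (X : V -> Prop) b i (f : 'I_4 -> 'I_4 -> V) :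
  (forall u v, X u -> X v -> X (u + v)) -> (forall c u, X u -> X (c *: u)) -> i != o0 ->
  (forall u v, wadd (wgen u) (wgen v) = wgen i -> X (f u v)) -> X (rel_elt b i f).
Proof.
move=> XD XZ i0 Xf; have h := wgen_nx i0.
have XB u v : X u -> X v -> X (u - v) by move=> ? ?; rewrite -scaleN1r; apply/XD/XZ.
by case: b; rewrite /rel_elt; apply: (XD); [apply: XB| |apply: XB| ]; apply: XZ; apply: Xf;
   first [exact: wadd0|exact: h|rewrite waddC; first [exact: wadd0|exact: h]].
Qed.

Lemma rel_eltB (V : lmodType k) b i (f g : 'I_4 -> 'I_4 -> V) :
  rel_elt b i (fun u v => f u v - g u v) = rel_elt b i f - rel_elt b i g.
Proof.
have [[[hA hC] [hA' hC']] [hA2 hC2]] := (rel_elt_lin4 i f, rel_elt_lin4 i g,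
  rel_elt_lin4 i (fun u v => f u v - g u v)).
case: b; rewrite ?hA ?hA' ?hA2 ?hC ?hC' ?hC2 /lin4 !scalerBr !opprD;
  by rewrite [LHS](AC (2*2*2*2) ((1*3*5*7)*(2*4*6*8))).
Qed.

Lemma rel_elt_sumr (V : lmodType k) b i (q : pt) (z : 'I_4 -> V) :
  rel_elt b i (fun u v => q u *: z v)
  = \sum_v rel_form b i q (fun w => (w == v)%:R) *: z v.
Proof.
have S (c : k) w : \sum_v (c * (w == v)%:R) *: z v = c *: z w.
  rewrite (bigD1 w) //= eqxx mulr1 big1 ?addr0 // => v; rewrite eq_sym => /negbTE->.
  by rewrite mulr0 scale0r.
rewrite /rel_elt /rel_form; case: b.
  under eq_bigr => v _ do rewrite scalerDl scalerBl !mulrA.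
  by rewrite big_split sumrB /= !S !scalerA.
under eq_bigr => v _ do rewrite scalerDl scalerBl !mulrA.
by rewrite big_split sumrB /= !S !scalerA.
Qed.

Lemma rel_form_sumr b i (q y : pt) :
  rel_form b i q y = \sum_v rel_form b i q (fun w => (w == v)%:R) * y v.
Proof. exact: (rel_elt_sumr b i q (y : 'I_4 -> k^o)). Qed.

(** Duality: if the scalar solutions of the relations with index in [I] are all proportional to
    [q'], then vectors that satisfy these relations modulo the subspace [X] are proportional to [q']
    modulo [X]. *)
Lemma rel_elt_span (V : lmodType k) (X : V -> Prop) (I : pred 'I_4) (q q' : pt) (z : 'I_4 -> V) :
  X 0 -> (forall u v, X u -> X v -> X (u + v)) -> (forall c u, X u -> X (c *: u)) ->
  (forall y : pt, (forall b i, I i -> rel_form b i q y = 0) ->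
     forall u v, y u * q' v = y v * q' u) ->
  (forall b i, I i -> X (rel_elt b i (fun u v => q u *: z v))) ->
  forall u v, X (q' v *: z u - q' u *: z v).
Proof.
move=> X0 XD XZ ker Xz u v.
pose R (r : bool * 'I_4) w := if I r.2 then rel_form r.1 r.2 q (fun w' => (w' == w)%:R) else 0.
pose M : 'M[k]_(#|{: bool * 'I_4}|, 4) := \matrix_(r, w) R (enum_val r) w.
pose W : 'rV[k]_4 := \row_w (q' v * (u == w)%:R - q' u * (v == w)%:R).
(* By the kernel hypothesis [W] annihilates every column of the cokernel of [M], hence it is a
   combination of the relations. *)
have /submxP[D WD] : (W <= M)%MS.
  rewrite submxE; move: (cokermx M) (mulmx_coker M) => K MK.
  apply/eqP/matrixP => r j; rewrite !mxE; pose y : pt := fun w => K w j.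
  rewrite (eq_bigr (fun w => q' v * (u == w)%:R * y w - q' u * (v == w)%:R * y w)); last first.
    by move=> w _; rewrite !mxE mulrBl.
  have S (c : k) w : \sum_v (c * (w == v)%:R) * y v = c * y w.
    rewrite (bigD1 w) //= eqxx mulr1 big1 ?addr0 // => v'; rewrite eq_sym => /negbTE->.
    by rewrite mulr0 mul0r.
  have ry b i : I i -> rel_form b i q y = 0.
    move=> Ii; rewrite rel_form_sumr.
    have /matrixP/(_ (enum_rank (b, i)) j) := MK; rewrite mxE [RHS]mxE => e0.
    rewrite -[RHS]e0; apply: eq_bigr => w _.
    by rewrite !mxE enum_rankK /R Ii.
  have e := ker y ry u v.
  rewrite sumrB (S (q' v) u) (S (q' u) v) (mulrC (q' v)) (mulrC (q' u)) e.
  exact: subrr.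
have -> : q' v *: z u - q' u *: z v = \sum_w W 0 w *: z w.
  have S (c : k) w : \sum_v (c * (w == v)%:R) *: z v = c *: z w.
    rewrite (bigD1 w) //= eqxx mulr1 big1 ?addr0 // => v'; rewrite eq_sym => /negbTE->.
    by rewrite mulr0 scale0r.
  by under eq_bigr => w _ do rewrite mxE scalerBl; rewrite sumrB !S.
rewrite WD.
under eq_bigr => w _ do rewrite mxE scaler_suml.
rewrite exchange_big /=.
elim/big_ind: _ => // r _.
under eq_bigr => w _ do rewrite -scalerA.
rewrite -scaler_sumr; apply: XZ.
under eq_bigr => w _ do rewrite mxE.
rewrite /R; case: (enum_val r) => b i /=; case Ii: (I i).
  by rewrite -rel_elt_sumr; apply: Xz.
by rewrite big1 // => w _; rewrite scale0r.
Qed.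

End Spanning.

(** * Words modulo x_0 B: the inductive step *)

Section Faithful.
Variables (k : closedFieldType) (a1 a2 a3 : k).
Hypothesis Ha : generic_alpha a1 a2 a3.
Local Notation pt := ('I_4 -> k).
Local Notation chain := (chain a1 a2 a3).
Local Notation onEaff := (onEaff a1 a2 a3).
Local Notation al := (al a1 a2 a3).
Local Notation rel_form := (rel_form a1 a2 a3).
Local Notation rel_elt := (rel_elt a1 a2 a3).
Variables (B : algType k) (x : 'I_4 -> B).
Hypothesis relx : forall b i, i != o0 -> rel_elt b i (fun u v => x u * x v) = 0.

(** Degree and weight belong to the cofactor of x_0, to which the induction of [wcomb_eq0] is
    applied. *)
Definition x0_multiple (n : nat) (t : weight) (b : B) : Prop :=
  exists2 L, homog n t L & b = x o0 * wcomb x L.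

Lemma x0_multiple_0 n t : x0_multiple n t 0.
Proof. by exists [::]; rewrite // /wcomb big_nil mulr0. Qed.

Lemma x0_multipleD n t b b' : x0_multiple n t b -> x0_multiple n t b' -> x0_multiple n t (b + b').
Proof.
case=> L hL -> [L' hL' ->]; exists (L ++ L'); first by rewrite /homog all_cat; apply/andP.
by rewrite /wcomb big_cat mulrDr.
Qed.

Lemma x0_multipleZ n t c b : x0_multiple n t b -> x0_multiple n t (c *: b).
Proof.
case=> L hL ->; exists [seq (c * u.1, u.2) | u <- L]; first by rewrite /homog all_map.
rewrite scalerAr /wcomb big_map scaler_sumr; congr (_ * _).
by apply: eq_bigr => u _; rewrite scalerA.
Qed.

Lemma x0_multipleM n t b j : x0_multiple n t b -> x0_multiple n.+1 (wadd t (wgen j)) (b * x j).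
Proof.
case=> L hL ->; exists [seq (u.1, rcons u.2 j) | u <- L].
  rewrite /homog all_map; apply: sub_all hL => u /= /andP[/eqP <- /eqP <-].
  by rewrite size_rcons wsum_rcons !eqxx.
rewrite -mulrA /wcomb big_map mulr_suml; congr (_ * _).
by apply: eq_bigr => u _; rewrite wprod_rcons scalerAl.
Qed.

Lemma x0_multiple_x j : x0_multiple 1 (wgen j) (x o0 * x j).
Proof.
exists [:: (1, [:: j])]; first by rewrite /homog /= waddC wadd0 eqxx.
by rewrite /wcomb big_seq1 scale1r /wprod big_seq1.
Qed.

Lemma rel_elt_mull b i (y : B) (f : 'I_4 -> 'I_4 -> B) :
  rel_elt b i (fun u v => y * f u v) = y * rel_elt b i f.
Proof. by rewrite /rel_elt; case: b; rewrite mulrDr mulrBr !scalerAr. Qed.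

Lemma rel_eltZ (V : lmodType k) b i e (f : 'I_4 -> 'I_4 -> V) :
  rel_elt b i (fun u v => e *: f u v) = e *: rel_elt b i f.
Proof.
have C d (v : V) : d *: (e *: v) = e *: (d *: v) by rewrite !scalerA mulrC.
by rewrite /rel_elt; case: b; rewrite scalerDr scalerBr !(C _ (f _ _)).
Qed.

Section Special.
Variable c : nat -> pt.
Hypotheses (hc : chain c) (c0E : onEaff (c 0%N)) (c00 : c 0%N o0 = 0).

(* Modulo [x_0 B], the words of given length and weight are proportional to *)
(* their values along [c].                                                   *)
Definition proportional (n : nat) : Prop := exists m : weight -> B,
  forall w, size w = n ->
  x0_multiple n.-1 (wsum w) (wprod x w - eval_word c 0 w *: m (wsum w)).

(** A relation of index i preceded by a word with nonzero value gives, after division by that value,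
    the same relation for the elements m(t + wgen j) x_j modulo x_0 B. If enough indices i admit
    such a word, [rel_elt_span] makes these elements proportional to the coordinates of the next
    point. *)
Lemma proportional_step n : (0 < n)%N -> proportional n ->
  (forall t, exists I : pred 'I_4,
    [/\ forall i, I i -> i != o0,
        forall i, I i -> exists w, [/\ size w = n.-1,
          wsum w = wadd t (wgen i) & eval_word c 0 w != 0]
      & forall y, (forall b i, I i -> rel_form b i (c n.-1) y = 0) ->
          forall u v, y u * c n v = y v * c n u]) ->
  proportional n.+1.
Proof.
case: n => // n _ [m mP] hI /=.
have [_ [v0 cv] _] := hc n.+1.
exists (fun t => (c n.+1 v0)^-1 *: (m (wadd t (wgen v0)) * x v0)).
move=> w; case/lastP: w => // w u; rewrite size_rcons => -[sw] /=.
set t := wsum _; have [I [I0 Iw Ik]] := hI t.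
have tw : wsum w = wadd t (wgen u).
  by rewrite /t wsum_rcons waddrK.
pose z j := m (wadd t (wgen j)) * x j.
have Xz b i : I i -> x0_multiple n.+1 t (rel_elt b i (fun u v => c n u *: z v)).
  move=> Ii; have [w0 [s0 tw0 e0]] := Iw i Ii; have i0 := I0 i Ii.
  pose e := eval_word c 0 w0.
  have : x0_multiple n.+1 t (rel_elt b i (fun u v => wprod x w0 * (x u * x v) - e *: (c n u *:
    z v))).
    apply: rel_elt_closed i0 _ => [y y'|d y|u' v uv]; first exact: x0_multipleD.
      exact: x0_multipleZ.
    have tv : wsum (rcons w0 u') = wadd t (wgen v).
      by rewrite wsum_rcons tw0 -uv; case: (t) (wgen u') (wgen v) => [[] []] [[] []] [[] []].
    have := x0_multipleM v (mP (rcons w0 u') _); rewrite size_rcons s0 => /(_ erefl).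
    rewrite tv wprod_rcons eval_word_rcons add0n s0 mulrBl -mulrA -scalerAl -scalerA.
    by rewrite waddrK.
  rewrite rel_eltB rel_elt_mull relx // mulr0 sub0r rel_eltZ => /(x0_multipleZ (- e^-1)).
  by rewrite scalerN scaleNr opprK scalerA mulVf // scale1r.
have H := rel_elt_span (x0_multiple_0 n.+1 t) (@x0_multipleD n.+1 t) (@x0_multipleZ n.+1 t) Ik
  Xz u v0.
rewrite wprod_rcons eval_word_rcons add0n sw.
(* The first summand replaces the word without its last letter by its value; the second replaces
   that last letter by [v0]. *)
rewrite (_ : _ - _ = (wprod x w - eval_word c 0 w *: m (wsum w)) * x u +
  (eval_word c 0 w / c n.+1 v0) *: (c n.+1 v0 *: z u - c n.+1 u *: z v0)).
  apply: x0_multipleD; last exact: x0_multipleZ.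
  by have := x0_multipleM u (mP w sw); rewrite -wsum_rcons.
rewrite mulrBl -scalerAl tw -/(z u) scalerBr !scalerA divfK // addrA subrK.
by congr (_ - _ *: _); ring.
Qed.

End Special.
End Faithful.

(** * The algebra modulo the right ideal generated by [x_0] *)

Lemma nx_neq0 i : i != o0 -> nx i != o0.
Proof. by move: i; apply: ord4P. Qed.

Lemma nx3 i : nx (nx (nx i)) = i.
Proof. by move: i; apply: ord4P. Qed.

Section Special.
Variables (k : closedFieldType) (a1 a2 a3 : k).
Hypothesis Ha : generic_alpha a1 a2 a3.
Local Notation pt := ('I_4 -> k).
Local Notation chain := (chain a1 a2 a3).
Local Notation onEp := (onEp a1 a2 a3).
Local Notation onEaff := (onEaff a1 a2 a3).
Local Notation al := (al a1 a2 a3).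
Local Notation rel_form := (rel_form a1 a2 a3).
Local Notation rel_elt := (rel_elt a1 a2 a3).

Variable c : nat -> pt.
Hypotheses (hc : chain c) (c0E : onEaff (c 0%N)) (c00 : c 0%N o0 = 0).
Let p := c 0%N.
Let q := c 1%N.

Lemma two_neq0 : 2 != 0 :> k. Proof. by case: Ha. Qed.

Lemma special_neq0 i : i != o0 -> p i != 0.
Proof.
have p1 : p o1 != 0 by rewrite /p c0E.2 oner_neq0.
have [p2 p3] := onE_neq23 Ha c0E.1 c00 p1.
by move: i; apply: ord4P.
Qed.

Lemma special_next i : i != o0 ->
  (2 * al i) * (p (nx i) * q (nx (nx i))) = - (1 - al i) * (p i * q o0) /\
  (2 * al i) * (p (nx (nx i)) * q (nx i)) = - (1 + al i) * (p i * q o0).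
Proof.
move=> i0; have [_ _ [r _ _]] := hc 0.
have h b : rel_elt b i (fun u v => p u * q v : k^o) = 0 by exact: (r b i i0).
have [h1 h2] := rel_elt_solve Ha h.
have e : p o0 * q i = 0 by rewrite /p c00 mul0r.
move: h1 h2; rewrite /= e !scaler0 !add0r.
by move=> /eqP + /eqP; rewrite !addr_eq0 => /eqP e1 /eqP e2; split;
  rewrite mulNr -?[_ * (p i * _)]e1 -?[_ * (p i * _)]e2 ?[X in - X]e1 ?[X in - X]e2 opprK.
Qed.

Lemma special_next_neq0 j : q j != 0.
Proof.
have n2 := two_neq0.
have q0 : q o0 != 0.
  apply/eqP => z; have [_ [u qu] _] := hc 1.
  have H i : i != o0 -> q (nx (nx i)) = 0.
    move=> i0; have [na _ _] := al_neq0 Ha i0; have [+ _] := special_next i0.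
    rewrite z !mulr0 => /eqP; rewrite !mulf_eq0 (negbTE n2) (negbTE na).
    by rewrite (negbTE (special_neq0 (nx_neq0 i0))) => /eqP.
  by move: u qu; apply: ord4P; rewrite -/q ?z ?(H o1) ?(H o2) ?(H o3) ?eqxx.
have H i : i != o0 -> q (nx (nx i)) != 0.
  move=> i0; have [na _ ma] := al_neq0 Ha i0; have [+ _] := special_next i0.
  move=> e; apply/eqP => z; move/eqP: e; rewrite z !mulr0 eq_sym.
  by rewrite !(mulf_eq0, oppr_eq0) (negbTE ma) (negbTE (special_neq0 i0)) (negbTE q0).
by move: j; apply: ord4P => //; [exact: (H o2)|exact: (H o3)|exact: (H o1)].
Qed.

(** All coordinates of q are nonzero, so [x_1 x_1] and the words [x_j x_0] with j nonzero cover all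
    weights in length two; longer words are extended by a letter that does not vanish. *)
Lemma special_words n t : exists w, [/\ size w = n.+2, wsum w = t & eval_word c 0 w != 0].
Proof.
elim: n t => [|n IH] t.
  have [j <-] := wgen_onto t; case: (eqVneq j o0) => [->|j0].
    by exists [:: o1; o1]; split; rewrite //= mulr1 mulf_neq0 ?special_next_neq0 ?special_neq0.
  exists [:: j; o0]; split=> //=; last by rewrite mulr1 mulf_neq0 ?special_next_neq0 ?special_neq0.
  by rewrite waddC; case: (wgen j) => [[] []].
have [_ [j cj] _] := hc n.+2.
have [w [sw tw ew]] := IH (wadd t (wgen j)); exists (rcons w j).
rewrite size_rcons sw wsum_rcons tw eval_word_rcons sw add0n mulf_neq0 //; split=> //.
by case: (t) (wgen j) => [[] []] [[] []].
Qed.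

Lemma special_words1 t : t != (false, false) ->
  exists w, [/\ size w = 1%N, wsum w = t & eval_word c 0 w != 0].
Proof.
have [j <-] := wgen_onto t => t0.
have j0 : j != o0 by apply: contraNneq t0 => ->.
exists [:: j]; split; rewrite //= ?mulr1 ?special_neq0 //.
by rewrite waddC wadd0.
Qed.

(** From degree two to three one index of relations may be missing, and two consecutive indices have
    to suffice. Through [special_next] the relations at q become relations between y and p; the two
    indices give opposite values for [p l * y i], where l is [nx (nx i)], and 2 is invertible. *)
Lemma special_kernel0 i (y : pt) : i != o0 -> y o0 = 0 ->
  (forall b, rel_form b i q y = 0) -> (forall b, rel_form b (nx i) q y = 0) ->
  forall u, y u = 0.
Proof.
move=> i0 y0 ri rj; have n2 := two_neq0; have q0 := special_next_neq0 o0.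
have H i' : i' != o0 -> (forall b, rel_form b i' q y = 0) ->
    p (nx i') * y (nx (nx i')) = p (nx (nx i')) * y (nx i') /\
    p (nx (nx i')) * y i' = - (p i' * y (nx (nx i'))).
  move=> i0' r; have [na pa ma] := al_neq0 Ha i0'.
  have pi := special_neq0 i0'; have pj := special_neq0 (nx_neq0 i0').
  have pl := special_neq0 (nx_neq0 (nx_neq0 i0')).
  have [f1 f2] := special_next i0'.
  have rA := r true; have rC := r false; rewrite /rel_form y0 in rA rC.
  move: pi pj pl f1 f2 rA rC na pa ma.
  move: (p i') (p (nx i')) (p (nx (nx i'))) (q i') (q (nx i')) (q (nx (nx i'))) (q o0) q0
    (y i') (y (nx i')) (y (nx (nx i'))) (al i').
  move=> pi pj pl qi qj ql q0' nq0 yi yj yl a npi npj npl f1 f2 rA rC na pa ma.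
  have e1 : pj * yl = pl * yj.
    have nz : (1 + a) * (1 - a) * (pi * q0') != 0 by rewrite !mulf_neq0.
    apply: (mulfI nz); apply/eqP; rewrite -subr_eq0; apply/eqP.
    transitivity (2 * a * pj * pl * (2 * (qi * 0) - (1 - a) * (qj * yl) + (1 + a) * (ql * yj))
      + (1 - a) * pj * yl * (2 * a * (pl * qj) - - (1 + a) * (pi * q0'))
      - (1 + a) * pl * yj * (2 * a * (pj * ql) - - (1 - a) * (pi * q0'))); first by ring.
    by rewrite f1 f2 rC !subrr !mulr0 subr0 addr0.
  split=> //.
  have nz : 2 * 2 * a * pj * q0' != 0 by rewrite !mulf_neq0.
  apply: (mulfI nz); apply/eqP; rewrite -subr_eq0; apply/eqP.
  transitivity (2 * a * pj * pl * (2 * (q0' * yi) - (1 + a) * (qj * yl) + (1 - a) * (ql * yj))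
      + (1 + a) * pj * yl * (2 * a * (pl * qj) - - (1 + a) * (pi * q0'))
      - (1 - a) * pl * yj * (2 * a * (pj * ql) - - (1 - a) * (pi * q0'))
      - (1 - a) * (1 - a) * pi * q0' * (pj * yl - pl * yj)); first by ring.
  by rewrite f1 f2 rA e1 !subrr !mulr0 addr0 !subr0.
have j0 := nx_neq0 i0; have l0 := nx_neq0 j0.
have [e1 e2] := H i i0 ri; have [e3 _] := H (nx i) j0 rj; rewrite nx3 in e3.
have yl : y (nx (nx i)) = 0.
  have nz : 2 * p i != 0 by rewrite mulf_neq0 // special_neq0.
  apply: (mulfI nz); rewrite mulr0 -mulrA mulr2n mulrDl mul1r -{1}e3 e2 addNr //.
have yj : y (nx i) = 0.
  by apply: (mulfI (special_neq0 l0)); rewrite -e1 yl !mulr0.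
have yi : y i = 0.
  by apply: (mulfI (special_neq0 l0)); rewrite e2 yl !mulr0 oppr0.
move: yl yj yi; move: i i0 {ri rj j0 l0 e1 e2 e3}; apply: ord4P => // _ yl yj yi;
  apply: ord4P => //.
Qed.

End Special.

Definition windex (t : weight) : 'I_4 :=
  match t with (false, false) => o0 | (true, true) => o1 | (false, true) => o2 | _ => o3 end.

Lemma wgenK : cancel wgen windex.
Proof. by apply: ord4P. Qed.

(** * Homogeneous elements are detected by their values *)

Section Faithful.
Variables (k : closedFieldType) (a1 a2 a3 : k).
Hypothesis Ha : generic_alpha a1 a2 a3.
Local Notation pt := ('I_4 -> k).
Local Notation chain := (chain a1 a2 a3).
Local Notation onEp := (onEp a1 a2 a3).
Local Notation onEaff := (onEaff a1 a2 a3).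
Local Notation al := (al a1 a2 a3).
Local Notation rel_form := (rel_form a1 a2 a3).
Local Notation rel_elt := (rel_elt a1 a2 a3).
Local Notation nonvanishing := (nonvanishing a1 a2 a3).

Let la := (1 + a1) / (1 - a2).
Let mu := (1 - a1) / (1 + a3).

Lemma la_mu_neq0 : la - mu != 0.
Proof.
have h := generic_mul_neq0 Ha; have e := generic_third Ha.
have [_ _ [n1 p1 m1] [n2 p2 m2] [n3 p3 m3]] := Ha.
have p3' : 1 + a3 = (1 - a1) * (1 - a2) / (1 + a1 * a2) by rewrite e; field.
rewrite /la /mu p3'.
have -> : (1 + a1) / (1 - a2) - (1 - a1) / ((1 - a1) * (1 - a2) / (1 + a1 * a2)) =
   a1 / (1 - a2) * (1 - a2) by field; rewrite ?m1 ?m2 ?h.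
by rewrite !mulf_neq0 ?invr_eq0.
Qed.

Lemma omega_solve (V : lmodType k) (f : 'I_4 -> 'I_4 -> V) :
  - f o0 o0 + f o1 o1 + f o2 o2 + f o3 o3 = 0 ->
  f o1 o1 + la *: f o2 o2 + mu *: f o3 o3 = 0 ->
  mu *: f o0 o0 + (1 - mu) *: f o1 o1 + (la - mu) *: f o2 o2 = 0 /\
  la *: f o0 o0 + (1 - la) *: f o1 o1 + (mu - la) *: f o3 o3 = 0.
Proof.
move: (f o0 o0) (f o1 o1) (f o2 o2) (f o3 o3) => u v s t h1 h2.
have e1 : lin4 u v s t (-1) 1 1 1 = 0 by rewrite /lin4 !scale1r scaleN1r.
have e2 : lin4 u v s t 0 1 la mu = 0 by rewrite /lin4 scale0r add0r scale1r.
split.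
  transitivity (lin4 u v s t 0 1 la mu + (- mu) *: lin4 u v s t (-1) 1 1 1).
    rewrite lin4Z lin4D (_ : mu *: u + _ + _ = lin4 u v s t mu (1 - mu) (la - mu) 0).
      by congr lin4; ring.
    by rewrite /lin4 scale0r addr0.
  by rewrite e1 e2 scaler0 addr0.
transitivity (lin4 u v s t 0 1 la mu + (- la) *: lin4 u v s t (-1) 1 1 1).
  rewrite lin4Z lin4D (_ : la *: u + _ + _ = lin4 u v s t la (1 - la) 0 (mu - la)).
    by congr lin4; ring.
  by rewrite /lin4 scale0r addr0.
by rewrite e1 e2 scaler0 addr0.
Qed.

Variables (B : algType k) (x : 'I_4 -> B).
Hypothesis relx : forall b i, i != o0 -> rel_elt b i (fun u v => x u * x v) = 0.
Hypothesis omx : omega x = 0.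
Hypothesis omx' : omega' x a1 a2 a3 = 0.

Section Special.
Variable c : nat -> pt.
Hypotheses (hc : chain c) (c0E : onEaff (c 0%N)) (c00 : c 0%N o0 = 0).
Let p := c 0%N.
Let q := c 1%N.
Local Notation rm := (x0_multiple x).

(** Modulo x_0 B a relation with three terms makes two words proportional; the same relation holds
    for their values, so proportionality to the values passes from one word to the other. *)
Lemma x0_multiple_transfer (u v a b : 'I_4) (al be ga : k) (m : B) r : ga != 0 ->
  al *: (x o0 * x r) + be *: (x a * x b) + ga *: (x u * x v) = 0 ->
  be * (p a * q b) + ga * (p u * q v) = 0 ->
  x a * x b = (p a * q b) *: m ->
  rm 1 (wgen r) (x u * x v - (p u * q v) *: m).
Proof.
move=> g0 ex ep em.
have -> : x u * x v - (p u * q v) *: m = (- (ga^-1 * al)) *: (x o0 * x r).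
  have e1 : ga * (p u * q v) = - (be * (p a * q b)).
    by apply/eqP; rewrite -addr_eq0 addrC ep.
  have e2 : ga *: (x u * x v) = - (al *: (x o0 * x r) + be *: (x a * x b)).
    by apply/eqP; rewrite -addr_eq0 addrC ex.
  apply: (scalerI g0); rewrite scalerBr !scalerA mulrN mulVKf // e1 e2.
  by rewrite scaleNr opprK -scalerA -em opprD subrK scaleNr.
exact/x0_multipleZ/x0_multiple_x.
Qed.

Lemma proportional1 : proportional x c 1.
Proof.
exists (fun t => if windex t == o0 then 0 else (p (windex t))^-1 *: x (windex t)).
move=> [|j [|//]] // _; have -> : wsum [:: j] = wgen j by rewrite /= waddC wadd0.
rewrite [eval_word _ _ _]/= mulr1 -/p /wprod big_seq1 wgenK.
case: eqVneq => [->|j0].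
  rewrite scaler0 subr0; exists [:: (1, [::])] => //.
  by rewrite /wcomb big_seq1 scale1r /wprod big_nil mulr1.
rewrite scalerA mulfV ?scale1r ?subrr; first exact: x0_multiple_0.
exact: (special_neq0 Ha c0E c00 j0).
Qed.

Lemma proportional2 : proportional x c 2.
Proof.
pose m t := if windex t == o0 then (p o1 * q o1)^-1 *: (x o1 * x o1)
  else (p (windex t) * q o0)^-1 *: (x (windex t) * x o0).
have P0 i : i != o0 -> p i != 0 by move=> i0; exact: (special_neq0 Ha c0E c00 i0).
have Q0 i : q i != 0 by exact: (special_next_neq0 Ha hc c0E c00).
have n2 := two_neq0 Ha.
have m0 : x o1 * x o1 = (p o1 * q o1) *: m (wgen o0).
  by rewrite /m wgenK /= scalerA mulfV ?scale1r // mulf_neq0 ?P0.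
have mi i : i != o0 -> x i * x o0 = (p i * q o0) *: m (wgen i).
  by move=> i0; rewrite /m wgenK (negbTE i0) scalerA mulfV ?scale1r // mulf_neq0 ?P0.
have [s2 s3] := @omega_solve B (fun u v => x u * x v) omx omx'.
have Hpair i : i != o0 ->
   rm 1 (wgen i) (x (nx i) * x (nx (nx i)) - (p (nx i) * q (nx (nx i))) *: m (wgen i)) /\
   rm 1 (wgen i) (x (nx (nx i)) * x (nx i) - (p (nx (nx i)) * q (nx i)) *: m (wgen i)).
  move=> i0; have [na pa ma] := al_neq0 Ha i0.
  have [h1 h2] := rel_elt_solve Ha (fun b => relx b i0).
  have [f1 f2] := special_next Ha hc c00 i0.
  split; [apply: (x0_multiple_transfer _ h1 _ (mi i i0))|apply: (x0_multiple_transfer _ h2 _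
    (mi i i0))];
    rewrite ?mulf_neq0 //; rewrite ?f1 ?f2 -mulrDl; ring.
have [_ _ [_ wk wk']] := hc 0.
have [_ _ _ [_ p2 m2] [_ p3 m3]] := Ha.
have [t2 t3] : (1 - mu) * (p o1 * q o1) + (la - mu) * (p o2 * q o2) = 0 /\
    (1 - la) * (p o1 * q o1) + (mu - la) * (p o3 * q o3) = 0.
  have e00 : p o0 * q o0 = 0 by rewrite /p c00 mul0r.
  have [||r2 r3] := @omega_solve k^o (fun u v => p u * q v).
  - exact: wk.
  - apply: (mulfI (mulf_neq0 m2 p3)); rewrite mulr0 -[RHS]wk' /omega_form' /GRing.scale /= /la
    /mu /p /q.
    by field; rewrite m2 p3.
  by move: r2 r3; rewrite e00 !scaler0 !add0r.
have lm := la_mu_neq0; have ml : mu - la != 0 by rewrite -opprB oppr_eq0.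
have Hd2 : rm 1 (wgen o0) (x o2 * x o2 - (p o2 * q o2) *: m (wgen o0)).
  exact: x0_multiple_transfer lm s2 t2 m0.
have Hd3 : rm 1 (wgen o0) (x o3 * x o3 - (p o3 * q o3) *: m (wgen o0)).
  exact: x0_multiple_transfer ml s3 t3 m0.
exists m => -[|u [|v [|//]]] // _.
have -> : wsum [:: u; v] = wadd (wgen u) (wgen v) by rewrite /= [X in wadd _ X]waddC wadd0.
rewrite [eval_word _ _ _]/= mulr1 /wprod big_cons big_seq1 -/p -/q.
have [h1 h1'] := Hpair o1 isT; have [h2 h2'] := Hpair o2 isT; have [h3 h3'] := Hpair o3 isT.
have Hz v' : rm 1 (wgen v') (x o0 * x v' - (p o0 * q v') *: m (wgen v')).
  by rewrite {1}/p c00 mul0r scale0r subr0; exact: x0_multiple_x.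
have Hi i : i != o0 -> rm 1 (wgen i) (x i * x o0 - (p i * q o0) *: m (wgen i)).
  by move=> i0; rewrite -(mi i i0) subrr; exact: x0_multiple_0.
have H1 : rm 1 (wgen o0) (x o1 * x o1 - (p o1 * q o1) *: m (wgen o0)).
  by rewrite -m0 subrr; exact: x0_multiple_0.
move: u v; apply: ord4P => v; first by rewrite wadd0; exact: Hz.
- move: v; apply: ord4P; [exact: (Hi o1 isT)|exact: H1|exact: h3|exact: h2'].
- move: v; apply: ord4P; [exact: (Hi o2 isT)|exact: h3'|exact: Hd2|exact: h1].
- move: v; apply: ord4P; [exact: (Hi o3 isT)|exact: h2|exact: h1'|exact: Hd3].
Qed.

(** Degrees one and two are explicit; degree two uses the relations Omega and Omega' for the
    squares. From degree three on, [proportional_step] applies. *)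
Lemma proportional_ge1 n : proportional x c n.+1.
Proof.
case: n => [|[|n]]; [exact: proportional1|exact: proportional2|].
elim: n => [|n IH].
  apply: (proportional_step relx hc _ proportional2) => //.
  (* The index of weight [t] is dropped: it would need a letter of trivial weight, and x_0 vanishes
     at the starting point. *)
  move=> t; exists [pred i | (i != o0) && (wgen i != t)]; split.
  - by move=> i /andP[].
  - move=> i /andP[i0 it]; apply: (special_words1 Ha c0E c00); apply/eqP => e.
    by case/eqP: it; move: e; case: (t) (wgen i) => [[] []] [[] []].
  move=> y ry; have [E1 N1 [R1 _ _]] := hc 1; have [_ N2 _] := hc 2.
  have ker (z : pt) : z o0 = 0 -> (forall b i, (i != o0) && (wgen i != t) ->
    rel_form b i (c 1%N) z = 0) ->
      forall u, z u = 0.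
    move=> z0 rz; have [j] := wgen_onto t; move: j; apply: ord4P => jt.
    - by apply: (special_kernel0 Ha hc c0E c00 (isT : o1 != o0)) => // b; apply: rz; rewrite -jt.
    - by apply: (special_kernel0 Ha hc c0E c00 (isT : o2 != o0)) => // b; apply: rz; rewrite -jt.
    - by apply: (special_kernel0 Ha hc c0E c00 (isT : o3 != o0)) => // b; apply: rz; rewrite -jt.
    - by apply: (special_kernel0 Ha hc c0E c00 (isT : o1 != o0)) => // b; apply: rz; rewrite -jt.
  (* This combination of two solutions has coordinate 0 equal to zero, so it vanishes. *)
  have K u : y u * c 2%N o0 = y o0 * c 2%N u.
    apply/eqP; rewrite -subr_eq0; apply/eqP.
    apply: (ker (fun u => y u * c 2%N o0 - y o0 * c 2%N u)); first by rewrite subrr.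
    move=> b i it; have r := ry b i it; have r' := R1 b i (proj1 (andP it)).
    transitivity (rel_form b i (c 1%N) y * c 2%N o0 - y o0 * rel_form b i (c 1%N) (c 2%N)).
      by rewrite /rel_form; case: (b); ring.
    by rewrite r r' mul0r mulr0 subrr.
  have c20 : c 2%N o0 != 0.
    apply/eqP => z; case: N2 => u; rewrite (ker (c 2%N)) ?eqxx // => b i /andP[i0 _].
    exact: R1.
  by move=> u v; apply: (mulIf c20); rewrite mulrAC K [RHS]mulrAC K; ring.
apply: (proportional_step relx hc _ IH) => //.
move=> t; exists [pred i | i != o0]; split=> //.
- by move=> i _; exact: (special_words Ha hc c0E c00 n).
move=> y ry; have [En Nn [Rn _ _]] := hc n.+2.
exact (rel_form_line Ha En Nn (fun b i i0 => ry b i i0) Rn).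
Qed.

End Special.

Hypothesis evx : forall c n t L L', chain c -> homog n.+1 t L -> homog n t L' ->
  wcomb x L = x o0 * wcomb x L' -> eval_comb c 0 L = c 0%N o0 * eval_comb c 1 L'.

(** An element that vanishes along all chains equals x_0 b'. Were b' nonzero along some chain,
    [nonvanishing_succ] would provide a chain with nonzero x_0 at its start and nonzero b' after it,
    hence a nonzero value of the element. *)
Lemma wcomb_eq0 n t L : homog n t L -> ~ nonvanishing 0 L -> wcomb x L = 0.
Proof.
have [q qE q00] := onEaff_lift Ha 0.
have q0 : q o0 = 0 by apply/eqP; rewrite -[_ == _]orbb -mulf_eq0 q00.
have qn : nonzero_pt q by exists o1; rewrite qE.2 oner_neq0.
have [c hc c0] := chain_exists Ha qE.1 qn.
rewrite -c0 in qE q0; elim: n t L => [|n IH] t L hL nL.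
  have e : eval_comb c 0 L = 0 by apply: contrapT => /eqP e; apply: nL; exists c.
  rewrite -(scale0r (1 : B)) -e /wcomb /eval_comb scaler_suml big_seq [RHS]big_seq.
  apply: eq_bigr => -[a w] /(allP hL)/andP[/eqP/size0nil /= -> _].
  by rewrite /wprod big_nil mulr1.
have [m mP] := proportional_ge1 hc qE q0 n.
have eq0 c' : chain c' -> onEaff (c' 0%N) -> eval_comb c' 0 L = 0.
  by move=> hc' cE'; apply: contrapT => /eqP e; apply: nL; exists c'.
have [L' hL' e'] : x0_multiple x n t (wcomb x L).
  (* The subtracted terms add up to the value of [L] times [m t], which is zero. *)
  have -> : wcomb x L = \sum_(u <- L) u.1 *: (wprod x u.2 - eval_word c 0 u.2 *: m t).
    under [RHS]eq_bigr => u _ do rewrite scalerBr scalerA.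
    by rewrite sumrB -scaler_suml -/(eval_comb c 0 L) eq0 // scale0r subr0.
  rewrite big_seq; elim/big_ind: _ => [|y z|u /(allP hL)/andP[/eqP su /eqP tu]].
  - exact: x0_multiple_0.
  - exact: x0_multipleD.
  by apply: x0_multipleZ; have := mP u.2 su; rewrite tu.
rewrite e' (IH t L') ?mulr0 // => /(nonvanishing_succ Ha hL')[c' [hc' cE' c'0]].
have := evx hc' hL hL' e'; rewrite eq0 // => /esym/eqP.
by rewrite mulf_eq0 (negbTE c'0) => /= /eqP ->; rewrite eqxx.
Qed.

End Faithful.

(** * The twist by quaternions *)

Section Quaternion.
Variables (k : fieldType) (ii : k).
Hypotheses (n2 : 2 != 0 :> k) (ii2 : ii ^+ 2 = -1).

Lemma ii_neq0 : ii != 0.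
Proof. by apply/eqP => z; move/eqP: ii2; rewrite z expr0n eq_sym oppr_eq0 oner_eq0. Qed.

Lemma ord2P (P : 'I_2 -> Prop) : P ord0 -> P ord_max -> forall i, P i.
Proof.
move=> h0 h1 [[|[|//]] iP].
- by rewrite (_ : Ordinal iP = ord0) //; apply: val_inj.
- by rewrite (_ : Ordinal iP = ord_max) //; apply: val_inj.
Qed.

Lemma qmx_entries (V : lmodType k) (b : 'I_4 -> V) :
  [/\ \sum_j qmx ii j ord0 ord0 *: b j = b o0 + ii *: b o1,
      \sum_j qmx ii j ord_max ord_max *: b j = b o0 - ii *: b o1,
      \sum_j qmx ii j ord0 ord_max *: b j = ii *: b o2 - b o3
    & \sum_j qmx ii j ord_max ord0 *: b j = ii *: b o2 + b o3].
Proof.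
by split; rewrite big_ord4 /qmx /= !mxE /= ?(scale0r, scale1r, scaleN1r, scaleNr, add0r, addr0).
Qed.

Lemma qmx_free (V : lmodType k) (b : 'I_4 -> V) :
  (forall r s, \sum_j qmx ii j r s *: b j = 0) -> forall j, b j = 0.
Proof.
move=> h; have [e00 e11 e01 e10] := qmx_entries b; have i0 := ii_neq0.
rewrite h in e00; rewrite h in e11; rewrite h in e01; rewrite h in e10.
have D (u v : V) : 0 = u + v -> 0 = u - v -> u = 0 /\ v = 0.
  move=> h1 h2; have u0 : u = 0.
    apply: (scalerI n2); rewrite scaler0 scalerDl scale1r.
    by rewrite -[RHS]addr0 {1}h1 h2 addrACA subrr addr0.
  by split=> //; rewrite h1 u0 add0r.
have [b0 b1] := D _ _ e00 e11; have [b2 b3] := D _ _ e10 e01.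
by apply: ord4P => //; apply: (scalerI i0); rewrite scaler0.
Qed.

Lemma qmx_span (V : lmodType k) (M : 'I_2 -> 'I_2 -> V) :
  exists b : 'I_4 -> V, forall r s, M r s = \sum_j qmx ii j r s *: b j.
Proof.
pose u := M ord0 ord0; pose v := M ord_max ord_max.
pose s := M ord0 ord_max; pose t := M ord_max ord0.
have i0 := ii_neq0.
exists (fun j => nth 0 [:: lin4 u v s t 2^-1 2^-1 0 0; lin4 u v s t (2 * ii)^-1 (- (2 * ii)^-1) 0 0;
   lin4 u v s t 0 0 (2 * ii)^-1 (2 * ii)^-1; lin4 u v s t 0 0 (- 2^-1) 2^-1] j).
set b := (X in forall r s, _ = \sum_j _ *: X j).
have [e00 e11 e01 e10] := qmx_entries b.
have N c d e f : - lin4 u v s t c d e f = lin4 u v s t (- c) (- d) (- e) (- f).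
  by rewrite -scaleN1r lin4Z !mulN1r.
have L c d e f : c = 1 -> d = 0 -> e = 0 -> f = 0 -> u = lin4 u v s t c d e f.
  by move=> -> -> -> ->; rewrite /lin4 !scale0r !addr0 scale1r.
have L' c d e f : c = 0 -> d = 1 -> e = 0 -> f = 0 -> v = lin4 u v s t c d e f.
  by move=> -> -> -> ->; rewrite /lin4 !scale0r !addr0 add0r scale1r.
have L2 c d e f : c = 0 -> d = 0 -> e = 1 -> f = 0 -> s = lin4 u v s t c d e f.
  by move=> -> -> -> ->; rewrite /lin4 !scale0r !addr0 add0r scale1r.
have L3 c d e f : c = 0 -> d = 0 -> e = 0 -> f = 1 -> t = lin4 u v s t c d e f.
  by move=> -> -> -> ->; rewrite /lin4 !scale0r !addr0 add0r scale1r.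
by apply: ord2P; apply: ord2P; rewrite ?e00 ?e11 ?e01 ?e10 /b /= lin4Z ?N lin4D;
  [apply: L|apply: L2|apply: L3|apply: L']; field; rewrite ?n2 ?i0.
Qed.

Lemma qmx_comm g j : qmx ii g *m qmx ii j = gsgn k g j *: (qmx ii j *m qmx ii g).
Proof.
have e : ii * ii = -1 by rewrite -expr2.
apply/matrixP => r s; move: g j r s.
by apply: ord4P; apply: ord4P; apply: ord2P; apply: ord2P;
  rewrite /qmx /gsgn /= !mxE !big_ord_recl !big_ord0 !mxE /=; ring: e.
Qed.

Lemma qmx_conj g j : qmx ii g *m qmx ii j *m invmx (qmx ii g) = gsgn k g j *: qmx ii j.
Proof. by rewrite qmx_comm -scalemxAl mulmxK // qmx_unit. Qed.

End Quaternion.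

Section Twisted.
Variables (k : fieldType) (ii : k).
Hypotheses (n2 : 2 != 0 :> k) (ii2 : ii ^+ 2 = -1).
Variables (A : algType k) (gam : 'I_4 -> {lrmorphism A -> A}).

Definition twmx (b : 'I_4 -> A) : 'M[A]_2 := \sum_j mxtens (b j) (qmx ii j).

Lemma twmxE b r s : twmx b r s = \sum_j qmx ii j r s *: b j.
Proof. by rewrite /twmx summxE; apply: eq_bigr => j _; rewrite mxE. Qed.

Lemma gammaM_twmx g b :
  gammaM gam ii g (twmx b) = twmx (fun j => gsgn k g j *: gam g (b j)).
Proof.
have [add0 addD] : gammaM gam ii g 0 = 0 /\ {morph gammaM gam ii g : M N / M + N}.
  split; first by rewrite /gammaM map_mx0 mulmx0 mul0mx.
  by move=> M N; rewrite /gammaM map_mxD mulmxDr mulmxDl.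
rewrite /twmx (big_morph _ addD add0); apply: eq_bigr => j _.
rewrite gammaM_tens qmx_conj //; apply/matrixP => r s; rewrite !mxE.
by rewrite scalerA mulrC.
Qed.

(** The q_j form a basis of M_2(k) in which conjugation by q_g is diagonal with signs [gsgn g j];
    invariance is then read off coefficient by coefficient. *)
Lemma Btwist_decomp M : M \in Btwist_pred gam ii2 ->
  exists2 b, M = twmx b & forall g j, gam g (b j) = gsgn k g j *: b j.
Proof.
move=> /Btwist_predP hM; have [b hb] := qmx_span n2 ii2 M.
have Mb : M = twmx b by apply/matrixP => r s; rewrite twmxE.
exists b => // g j; have := hM g; rewrite Mb gammaM_twmx => /matrixP e.
have /(_ _ j) h := qmx_free n2 ii2 (b := fun j => gsgn k g j *: gam g (b j) - b j).
have {}h : gsgn k g j *: gam g (b j) - b j = 0.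
  apply: h => r s; under eq_bigr => j' _ do rewrite scalerBr.
  by rewrite sumrB -!twmxE e subrr.
by rewrite -[b j in RHS](subrK (gsgn k g j *: gam g (b j))) -opprB h oppr0 add0r scalerA
  gsgn_sqr scale1r.
Qed.

End Twisted.

(** * Components for weight and degree *)

Section WeightDecomposition.
Variables (k : closedFieldType) (A : algType k) (x : 'I_4 -> A).
Variable gam : 'I_4 -> {lrmorphism A -> A}.
Hypothesis n2 : 2 != 0 :> k.
Hypothesis gamx : forall g j, gam g (x j) = gsgn k g j *: x j.

Definition wsgn (g : 'I_4) (t : weight) : k := gsgn k g (windex t).

Lemma wsgn_gen g j t : wsgn g (wadd (wgen j) t) = gsgn k g j * wsgn g t.
Proof.
move: g j; apply: ord4P; apply: ord4P; case: t => [[] []]; rewrite /wsgn /gsgn /=;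
  by rewrite ?(mulrNN, mulr1, mul1r).
Qed.

Lemma gam_wprod g w : gam g (wprod x w) = wsgn g (wsum w) *: wprod x w.
Proof.
elim: w => [|j w IH]; rewrite /wprod.
  by rewrite big_nil rmorph1 /wsgn /gsgn /= orbT scale1r.
rewrite !big_cons rmorphM /= gamx IH -scalerAl -scalerAr scalerA.
by rewrite wsgn_gen.
Qed.

Lemma wsgn_orth j t : \sum_g gsgn k g j * wsgn g t = if wgen j == t then 2 * 2 else 0.
Proof.
rewrite big_ord4; move: j; apply: ord4P; case: t => [[] []]; rewrite /wsgn /gsgn /=; ring.
Qed.

(** Averaging over Gamma: by orthogonality of characters only the words of the right weight survive,
    and 4 is invertible. *)
Lemma weight_component b j L : b = wcomb x L -> (forall g, gam g b = gsgn k g j *: b) ->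
  b = wcomb x [seq u <- L | wgen j == wsum u.2].
Proof.
move=> bL hb; have n4 : 2 * 2 != 0 :> k by rewrite mulf_neq0.
apply: (scalerI n4); rewrite /wcomb big_filter.
have -> : (2 * 2) *: b = \sum_g gsgn k g j *: gam g b.
  rewrite (eq_bigr (fun g => 1 *: b)); last first.
    by move=> g _; rewrite hb scalerA gsgn_sqr.
  by rewrite big_ord4 -!scalerDl; congr (_ *: _); ring.
rewrite bL /wcomb; under [LHS]eq_bigr => g _ do rewrite raddf_sum scaler_sumr.
rewrite exchange_big /= scaler_sumr [RHS]big_mkcond; apply: eq_bigr => u _.
under [LHS]eq_bigr => g _ do rewrite linearZ /= gam_wprod !scalerA mulrC mulrA.
rewrite -scaler_suml.
rewrite (eq_bigr (fun g => u.1 * (gsgn k g j * wsgn g (wsum u.2)))); last first.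
  by move=> g _; ring.
rewrite -mulr_sumr wsgn_orth; case: ifP => _; last by rewrite mulr0 scale0r.
by rewrite scalerA mulrC.
Qed.

(** The number of summands is free above a bound, so that several elements can be cut at a common
    degree. *)
Lemma homog_decomp b j L : b = wcomb x L -> (forall g, gam g b = gsgn k g j *: b) ->
  exists (F : nat -> seq (k * seq 'I_4)) (N0 : nat),
    (forall n, homog n (wgen j) (F n)) /\
    forall N, (N0 <= N)%N -> b = \sum_(n < N) wcomb x (F n).
Proof.
move=> bL /(weight_component bL) {bL}; set M := filter _ _ => bM.
exists (fun n => [seq u <- M | size u.2 == n]), (\max_(u <- M) size u.2).+1; split.
  move=> n; apply/allP => u; rewrite mem_filter => /andP[-> /=].
  by rewrite mem_filter eq_sym => /andP[].
move=> N hN; rewrite bM /wcomb.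
under [RHS]eq_bigr => n _ do rewrite big_filter big_mkcond.
rewrite exchange_big /= big_seq [RHS]big_seq; apply: eq_bigr => u uM.
have uN : (size u.2 < N)%N.
  apply: leq_trans hN; rewrite ltnS.
  exact: (@leq_bigmax_seq _ M xpredT (fun u => size u.2) u uM isT).
rewrite (bigD1 (Ordinal uN)) //= eqxx big1 ?addr0 // => n nu.
by case: eqP => // e; case/eqP: nu; apply: val_inj.
Qed.

End WeightDecomposition.

(** * Generic chains and change of position *)

Section Generic.
Variables (k : closedFieldType) (a1 a2 a3 : k).
Hypothesis Ha : generic_alpha a1 a2 a3.
Local Notation nonvanishing := (nonvanishing a1 a2 a3).
Local Notation chain := (chain a1 a2 a3).
Local Notation onEaff := (onEaff a1 a2 a3).

Lemma onEaff_nonzero_pt q : onEaff q -> nonzero_pt q.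
Proof. by move=> qE; exists o1; rewrite qE.2 oner_neq0. Qed.

Lemma onEaff_coord u : exists2 q, onEaff q & q u != 0.
Proof.
have [q qE q00] := onEaff_lift Ha 0; have q1 : q o1 != 0 by rewrite qE.2 oner_neq0.
have q0 : q o0 = 0 by apply/eqP; rewrite -[_ == _]orbb -mulf_eq0 q00.
have [q2 q3] := onE_neq23 Ha qE.1 q0 q1.
move: u; apply: ord4P; [|by exists q..].
have [r rE r00] := onEaff_lift Ha 1; exists r => //.
by apply/eqP => z; move/eqP: r00; rewrite z mul0r eq_sym oner_eq0.
Qed.

Definition gen_comb (u : 'I_4) : seq (k * seq 'I_4) := [:: (1, [:: u])].

Lemma homog_gen_comb u : homog 1 (wgen u) (gen_comb u).
Proof. by rewrite /homog /= waddC wadd0 eqxx. Qed.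

Lemma eval_comb_gen_comb c s u : eval_comb c s (gen_comb u) = c s u.
Proof. by rewrite /eval_comb big_seq1 /= mul1r mulr1. Qed.

Lemma nonvanishing_shiftn n t L s i : homog n t L -> nonvanishing s L -> nonvanishing (s + i)%N L.
Proof.
move=> hL hs; elim: i => [|i IH]; first by rewrite addn0.
by rewrite addnS; exact (nonvanishing_shift Ha hL IH).
Qed.

Lemma nonvanishing_gen_comb s u : nonvanishing s (gen_comb u).
Proof.
rewrite -[s]add0n; apply: nonvanishing_shiftn (homog_gen_comb u) _.
have [q qE qu] := onEaff_coord u.
have [c hc c0] := chain_exists Ha qE.1 (onEaff_nonzero_pt qE).
by exists c; rewrite eval_comb_gen_comb c0.
Qed.

Lemma eval_word_shiftn (c : nat -> 'I_4 -> k) s i w :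
  eval_word (fun j => c (s + j)%N) i w = eval_word c (s + i)%N w.
Proof. by elim: w i => //= j w IH i; rewrite IH addnS. Qed.

(** The tail from place [s] of a generic chain is itself a chain. Its first point is rescaled to
    [x_1 = 1], which is possible since x_1 is generically nonzero at place [s]. *)
Lemma nonvanishing_0 n t L s : homog n t L -> nonvanishing s L -> nonvanishing 0 L.
Proof.
move=> hL hs; have [f f0 fP] := nonvanishing_generic Ha hL hs.
have [g g0 gP] := nonvanishing_generic Ha (homog_gen_comb o1) (nonvanishing_gen_comb s o1).
have [_ [q qE]] := wfun_neq0M Ha f0 g0; rewrite mulf_eq0 negb_or => /andP[fq gq].
have [c hc c0] := chain_exists Ha qE.1 (onEaff_nonzero_pt qE).
have cs : c s o1 != 0 by rewrite -(eval_comb_gen_comb c s o1) gP // c0.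
have cL : eval_comb c s L != 0 by rewrite fP // c0.
pose l i := if i is 0%N then (c s o1)^-1 else 1.
have l0 i : l i != 0 by case: i => [|i]; rewrite /l ?invr_eq0 ?oner_neq0.
exists (fun i u => l i * c (s + i)%N u); split.
- move=> i; have [cE [u cu] cr] := hc (s + i)%N; split.
  + exact: onEp_scale.
  + by exists u; rewrite mulf_neq0.
  + have -> : (fun u => l i.+1 * c (s + i.+1)%N u) = c (s + i).+1.
      by apply/funext => v; rewrite /l mul1r addnS.
    exact: related_scalel.
- split; last by rewrite addn0 mulVf.
  by have [+ _ _] := hc (s + 0)%N; exact: onEp_scale.
rewrite (eval_comb_scale (c := fun i => c (s + i)%N) (l := l) _ hL) //.
rewrite mulf_neq0 //; first by apply/prodf_neq0.
rewrite (_ : eval_comb _ 0 L = eval_comb c s L) //.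
by apply: eq_bigr => u _; rewrite eval_word_shiftn addn0.
Qed.

Lemma ex_minimal (P : nat -> Prop) : (exists n, P n) ->
  exists2 n, P n & forall m, (m < n)%N -> ~ P m.
Proof.
move=> hP; have hP' : exists n, `[< P n >] by case: hP => n /asboolP; exists n.
exists (ex_minn hP'); case: ex_minnP => n /asboolP // Pn nmin m mn /asboolP /nmin.
by rewrite leqNgt mn.
Qed.

End Generic.

(** * Lowest components and primeness *)

Section Prime.
Variables (k : closedFieldType) (a1 a2 a3 ii : k).
Hypothesis Ha : generic_alpha a1 a2 a3.
Hypothesis ii2 : ii ^+ 2 = -1.
Local Notation nonvanishing := (nonvanishing a1 a2 a3).
Local Notation chain := (chain a1 a2 a3).
Local Notation onEaff := (onEaff a1 a2 a3).
Local Notation rel_elt := (rel_elt a1 a2 a3).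
Variables (A : algType k) (x : 'I_4 -> A) (gam : 'I_4 -> {lrmorphism A -> A}).
Hypothesis relx : forall b i, i != o0 -> rel_elt b i (fun u v => x u * x v) = 0.
Hypothesis omx : omega x = 0.
Hypothesis omx' : omega' x a1 a2 a3 = 0.
Hypothesis gamx : forall g j, gam g (x j) = gsgn k g j *: x j.
Hypothesis spanx : forall b : A, exists L, b = wcomb x L.
Hypothesis evx : forall c N, chain c ->
  exists e : {lrmorphism A -> 'M[k]_N.+1}, forall j, e (x j) = chain_mx c N j.

Lemma eval_comb_mulx0 c n t L L' : chain c -> homog n.+1 t L -> homog n t L' ->
  wcomb x L = x o0 * wcomb x L' -> eval_comb c 0 L = c 0%N o0 * eval_comb c 1 L'.
Proof.
move=> hc hL hL' eL; have [e he] := evx n.+1 hc.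
have := congr1 (fun M : 'M_n.+2 => M ord0 ord_max) (congr1 e eL).
rewrite /= (ev_wcomb _ _ he hL) rmorphM /= he chain_mx_mul /= add0n eqxx => ->.
by rewrite (ev_wcomb _ _ he hL') inordK //= add1n eqxx.
Qed.

Lemma wcomb_neq0_nzV n t L : homog n t L -> wcomb x L != 0 -> nonvanishing 0 L.
Proof.
move=> hL /eqP nz; apply: contrapT => nV; apply: nz.
exact: (wcomb_eq0 Ha relx omx omx' eval_comb_mulx0 hL nV).
Qed.

Lemma qmx_cancel (U W : 'M[k]_2) : (forall j, U *m qmx ii j *m W = 0) -> U = 0 \/ W = 0.
Proof.
have n2 := two_neq0 Ha.
move=> h; have hN (N : 'M[k]_2) : U *m N *m W = 0.
  have [b hb] := @qmx_span k ii n2 ii2 k^o N.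
  have -> : N = \sum_j b j *: qmx ii j.
    by apply/matrixP => r s; rewrite hb summxE; apply: eq_bigr => j _; rewrite !mxE mulrC.
  rewrite mulmx_sumr mulmx_suml big1 // => j _.
  by rewrite -scalemxAr -scalemxAl h scaler0.
case: (eqVneq U 0) => [|U0]; [by left|right; apply/matrixP => r s; rewrite mxE].
have [i [j Uij]] : exists i j, U i j != 0.
  apply: contrapT => H; case/eqP: U0; apply/matrixP => i j; rewrite mxE.
  by apply: contrapT => /eqP Uij; apply: H; exists i, j.
have /matrixP/(_ i s) := hN (delta_mx j r).
rewrite !mxE (bigD1 r) //= big1 => [|l lr].
  rewrite !mxE (bigD1 j) //= big1 => [|l lj].
    by rewrite !mxE !eqxx mulr1 !addr0 => /eqP; rewrite mulf_eq0 (negbTE Uij) => /eqP.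
  by rewrite !mxE (negbTE lj) mulr0.
rewrite !mxE big1 ?mul0r // => l' _.
by rewrite !mxE (negbTE lr) andbF mulr0.
Qed.

(** Lowest refers to values: every component below degree [n] vanishes along all chains. Some
    component does not, since otherwise all would be zero by [wcomb_eq0]. *)
Lemma Btwist_components M : M \in Btwist_pred gam ii2 -> M != 0 ->
  exists (F : 'I_4 -> nat -> seq (k * seq 'I_4)) (n N0 : nat),
  [/\ forall j m, homog m (wgen j) (F j m),
      forall N, (N0 <= N)%N -> M = twmx ii (fun j => \sum_(m < N) wcomb x (F j m)),
      exists j, nonvanishing 0 (F j n)
    & forall j m, (m < n)%N -> ~ nonvanishing 0 (F j m)].
Proof.
have n2 := two_neq0 Ha.
move=> /(Btwist_decomp n2)[b -> hb] Mn0.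
have H j : exists FN : (nat -> seq (k * seq 'I_4)) * nat,
    (forall n, homog n (wgen j) (FN.1 n)) /\
    forall N, (FN.2 <= N)%N -> b j = \sum_(n < N) wcomb x (FN.1 n).
  have [L hL] := spanx (b j).
  have [F [N0 [hF bF]]] := homog_decomp n2 gamx hL (fun g => hb g j).
  by exists (F, N0).
have [FN hFN] := choice H.
have bE N : (\max_j (FN j).2 <= N)%N -> forall j, b j = \sum_(m < N) wcomb x ((FN j).1 m).
  by move=> hN j; apply: (hFN j).2; apply: leq_trans hN; apply: leq_bigmax.
have [n [j nj] nmin] : exists2 n, (exists j, nonvanishing 0 ((FN j).1 n)) &
    forall m, (m < n)%N -> ~ exists j, nonvanishing 0 ((FN j).1 m).
  apply: ex_minimal; apply: contrapT => nex; case/eqP: Mn0.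
  rewrite /twmx big1 // => j _; rewrite (bE _ (leqnn _) j) big1 => [|m _].
    by apply/matrixP => r s; rewrite !mxE scaler0.
  apply: contrapT => /eqP /(wcomb_neq0_nzV ((hFN j).1 m)) nz.
  by apply: nex; exists m, j.
exists (fun j => (FN j).1), n, (\max_j (FN j).2); split.
- by move=> j' m; exact: (hFN j').1.
- by move=> N /bE hN; congr twmx; apply/funext.
- by exists j.
- by move=> j' m /nmin nV nj'; apply: nV; exists j'.
Qed.

Lemma ev_wcomb_sum c N (e : {lrmorphism A -> 'M[k]_N.+1}) t
    (F : nat -> seq (k * seq 'I_4)) K (r s : 'I_N.+1) :
  (forall j, e (x j) = chain_mx c N j) -> (forall m, homog m t (F m)) ->
  (r <= s)%N -> (s - r < K)%N ->
  e (\sum_(m < K) wcomb x (F m)) r s = eval_comb c r (F (s - r)%N).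
Proof.
move=> he hF rs sK; rewrite raddf_sum summxE (bigD1 (Ordinal sK)) //= big1 => [|m ms].
  by rewrite (ev_wcomb _ _ he (hF _)) subnKC // eqxx addr0.
rewrite (ev_wcomb _ _ he (hF _)); case: eqP => // e'; case/eqP: ms; apply: val_inj.
by rewrite /= e' addKn.
Qed.

Lemma wfun_neq0_big (I : eqType) (s : seq I) (f : I -> ('I_4 -> k) -> k) :
  (forall i, wfun_neq0 a1 a2 a3 (f i)) -> exists2 q, onEaff q & forall i, i \in s -> f i q != 0.
Proof.
move=> hf; have [_ [q qE]] : wfun_neq0 a1 a2 a3 (fun q => \prod_(i <- s) f i q).
  elim: s => [|i s IH].
    split; last by have [q qE _] := onEaff_lift Ha 0; exists q; rewrite ?big_nil ?oner_neq0.
    have [P [Q h]] := wfun1 a1 a2 a3.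
    by exists (false, false), P, Q => q qE; rewrite big_nil; exact: h.
  have [[t [P [Q h]]] [q qE nq]] := wfun_neq0M Ha (hf i) IH.
  split; last by exists q => //; rewrite big_cons.
  by exists t, P, Q => r rE; rewrite big_cons; exact: h.
by rewrite prodf_seq_neq0 => /allP h; exists q => // i /h.
Qed.

End Prime.

Section PrimeTwist.
Variables (k : closedFieldType) (a1 a2 a3 ii : k).
Hypothesis Ha : generic_alpha a1 a2 a3.
Hypothesis ii2 : ii ^+ 2 = -1.
Local Notation nonvanishing := (nonvanishing a1 a2 a3).
Local Notation chain := (chain a1 a2 a3).
Local Notation onEaff := (onEaff a1 a2 a3).
Local Notation rel_elt := (rel_elt a1 a2 a3).
Variables (A : algType k) (x : 'I_4 -> A) (gam : 'I_4 -> {lrmorphism A -> A}).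
Hypothesis relx : forall b i, i != o0 -> rel_elt b i (fun u v => x u * x v) = 0.
Hypothesis omx : omega x = 0.
Hypothesis omx' : omega' x a1 a2 a3 = 0.
Hypothesis gamx : forall g j, gam g (x j) = gsgn k g j *: x j.
Hypothesis spanx : forall b : A, exists L, b = wcomb x L.
Hypothesis evx : forall c N, chain c ->
  exists e : {lrmorphism A -> 'M[k]_N.+1}, forall j, e (x j) = chain_mx c N j.

Lemma mxtens_gen_invariant u : mxtens (x u) (qmx ii u) \in Btwist_pred gam ii2.
Proof.
apply/Btwist_predP => g; rewrite gammaM_tens qmx_conj // gamx.
by apply/matrixP => r s; rewrite !mxE scalerA mulrAC gsgn_sqr mul1r.
Qed.

(** Each requirement holds as soon as a certain nonzero function does not vanish at the starting
    point, and finitely many such functions have a common point where none vanishes. *)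
Lemma common_chain (F G : seq (k * seq 'I_4)) n m s t (L1 : homog n s F) (L2 : homog m t G) :
  nonvanishing 0 F -> nonvanishing 0 G -> exists c, [/\ chain c, onEaff (c 0%N),
    eval_comb c 0 F != 0,
    eval_comb c n.+1 G != 0 & forall u, c n u != 0].
Proof.
move=> hF /(nonvanishing_shiftn Ha n.+1 L2) hG.
have [f f0 fP] := nonvanishing_generic Ha L1 hF; have [g g0 gP] := nonvanishing_generic Ha L2 hG.
have /choice[h hP] : forall u, exists h, wfun_neq0 a1 a2 a3 h /\
    forall c, chain c -> onEaff (c 0%N) -> h (c 0%N) != 0 -> c n u != 0.
  move=> u; have [h h0 hP] := nonvanishing_generic Ha (homog_gen_comb k u)
    (nonvanishing_gen_comb Ha n u).
  by exists h; split=> // c hc cE /(hP c hc cE); rewrite eval_comb_gen_comb.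
(* The index type lists the six functions: [None] is [f], [Some None] is [g], and [Some (Some u)] is
   [h u]. *)
have [|q qE qP] := @wfun_neq0_big k a1 a2 a3 Ha (option (option 'I_4))
  (enum {: option (option 'I_4)})
  (fun o => if o is Some o' then if o' is Some u then h u else g else f).
  by move=> [[u|]|] //; have [] := hP u.
have [c hc c0] := chain_exists Ha qE.1 (onEaff_nonzero_pt qE).
exists c; split=> //; first by rewrite c0.
- by apply: fP; rewrite ?c0 // (qP None) ?mem_enum.
- by apply: gP; rewrite ?c0 // (qP (Some None)) ?mem_enum.
move=> u; have [_ hu] := hP u; apply: hu; rewrite ?c0 //.
by rewrite (qP (Some (Some u))) ?mem_enum.
Qed.

Lemma twmx_qmx (b : 'I_4 -> k) : \sum_j b j *: qmx ii j = 0 -> forall j, b j = 0.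
Proof.
move=> /matrixP h; apply: (@qmx_free k ii (two_neq0 Ha) ii2 k^o b) => r s.
have := h r s; rewrite summxE [RHS]mxE => e; rewrite -[RHS]e.
by apply: eq_bigr => j _; rewrite mxE mulrC.
Qed.

Lemma Btwist_prime : prime_ring (Btwist gam ii2).
Proof.
move=> I J [_ _ IM] [_ _ _] IJ; apply: contrapT => /not_orP[].
move=> /existsNP[a /not_implyP[Ia /eqP a0]] /existsNP[b /not_implyP[Jb /eqP b0]].
have abz u : Btwist_val a *m mxtens (x u) (qmx ii u) *m Btwist_val b = 0.
  pose d : Btwist gam ii2 := MkBtwist (mxtens_gen_invariant u).
  have Iad : I (a * d) by have := IM 1 a d Ia; rewrite mul1r.
  exact: (congr1 (@Btwist_val _ _ _ _ _) (IJ _ _ Iad Jb)).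
have va : Btwist_val a != 0 by apply: contraNneq a0 => e; apply/eqP/val_inj.
have vb : Btwist_val b != 0 by apply: contraNneq b0 => e; apply/eqP/val_inj.
have [F [n [N [hF aE [j0 Fj0] Fmin]]]] :=
  Btwist_components Ha relx omx omx' gamx spanx evx (valP a) va.
have [G [m [N' [hG bE [l0 Gl0] Gmin]]]] :=
  Btwist_components Ha relx omx omx' gamx spanx evx (valP b) vb.
have [c [hc cE Fc Gc cn]] := common_chain (hF j0 n) (hG l0 m) Fj0 Gl0.
(* [T] is the degree of the lowest term of a (x_u (x) q_u) b, read in the corner entry (0, T). *)
pose T := (n + m).+1; have [e he] := evx T hc.
pose K := (N + N' + T).+1.
have {}aE := aE K; have {}bE := bE K.
have KN : (N <= K)%N by rewrite /K -addnA leqW ?leq_addr.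
have KN' : (N' <= K)%N by rewrite /K addnAC leqW ?leq_addl.
have TK : (T < K)%N by rewrite ltnS leq_addl.
move/(_ KN) in aE; move/(_ KN') in bE.
pose al j := \sum_(i < K) wcomb x (F j i); pose be l := \sum_(i < K) wcomb x (G l i).
(* The corner entry is a sum over the place s of the letter x_u. Places s < n contribute zero by
   minimality of [n], places s > n by minimality of [m]. *)
have key u j l : e (al j * x u * be l) ord0 ord_max
    = eval_comb c 0 (F j n) * c n u * eval_comb c n.+1 (G l m).
  rewrite !rmorphM /= he -mulrA mxE.
  have nT : (n < T.+1)%N by rewrite ltnS ltnW // ltnS leq_addr.
  rewrite (bigD1 (Ordinal nT)) //= big1 ?addr0 => [|s sn].
    rewrite chain_mx_mul /= ltnS leq_addr (ev_wcomb_sum he (hF j)) /= ?subn0 //; last first.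
      exact: leq_ltn_trans TK.
    rewrite (ev_wcomb_sum he (hG l)) /= ?inordK ?ltnS ?leq_addr //.
      by rewrite subSS addKn mulrA.
    exact: leq_ltn_trans (leq_subr _ _) TK.
  rewrite chain_mx_mul; case: ltnP => sT; last by rewrite mulr0.
  rewrite (ev_wcomb_sum he (hF j)) //= ?subn0; last exact: leq_ltn_trans (ltnW sT) TK.
  case: (ltngtP s n) => [sn'|ns|e']; last by case/eqP: sn; apply: val_inj.
    rewrite (_ : eval_comb c 0 (F j s) = 0) ?mul0r //.
    by apply: contrapT => /eqP nz; apply: (Fmin j s sn'); exists c.
  rewrite (ev_wcomb_sum he (hG l)) /= ?inordK //; last exact: leq_ltn_trans (leq_subr _ _) TK.
  rewrite (_ : eval_comb c s.+1 _ = 0) ?mulr0 //.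
  apply: contrapT => /eqP nz; apply: (Gmin l (T - s.+1)%N).
    by rewrite subSS ltn_subLR ?ltn_add2r // -ltnS.
  by apply: (nonvanishing_0 Ha (hG l _) (s := s.+1)); exists c.
pose U := \sum_j eval_comb c 0 (F j n) *: qmx ii j.
pose W := \sum_l eval_comb c n.+1 (G l m) *: qmx ii l.
(* The corner entries of the vanishing product form [c n u] times this matrix, and [c n u] is
   nonzero. *)
have UW u : U *m qmx ii u *m W = 0.
  have := abz u; rewrite aE bE /twmx -/al -/be mulmx_suml mulmx_suml => ab.
  apply: (scalerI (cn u)); rewrite scaler0; apply/matrixP => r s; rewrite [RHS]mxE.
  have := congr1 (fun M : 'M[A]_2 => e (M r s) ord0 ord_max) ab.
  rewrite mxE raddf0 [RHS]mxE => ab'; rewrite -[RHS]ab' {ab ab'}.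
  rewrite summxE (raddf_sum e) summxE /U mulmx_suml mulmx_suml scaler_sumr summxE.
  apply: eq_bigr => j _; rewrite /W mulmx_sumr scaler_sumr summxE.
  rewrite [in RHS]mulmx_sumr [in RHS]summxE (raddf_sum e) [in RHS]summxE.
  apply: eq_bigr => l _.
  transitivity ((qmx ii j *m qmx ii u *m qmx ii l) r s * e (al j * x u * be l) ord0 ord_max).
    rewrite key -!scalemxAl -scalemxAr; move: (_ *m _ *m _) => q.
    by rewrite !(mxE scalemx_key); ring.
  rewrite -!mxtensM [X in _ = e X _ _](_ : _ =
    (qmx ii j *m qmx ii u *m qmx ii l) r s *: (al j * x u * be l)); last by rewrite [LHS]mxE.
  by rewrite linearZ [RHS]mxE.
have [/twmx_qmx h|/twmx_qmx h] := qmx_cancel Ha ii2 UW.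
  by move: Fc; rewrite (h j0) eqxx.
by move: Gc; rewrite (h l0) eqxx.
Qed.

End PrimeTwist.

Theorem corollary8p11 (k : closedFieldType) (a1 a2 a3 : k) (ii : k)
    (char_neq2 : 2%N \notin [pchar k])
    (alpha_eq : a1 + a2 + a3 + a1 * a2 * a3 = 0)
    (a1_generic : a1 \notin [:: 0; 1; -1])
    (a2_generic : a2 \notin [:: 0; 1; -1])
    (a3_generic : a3 \notin [:: 0; 1; -1])
    (ii2 : ii ^+ 2 = -1) :
  prime_ring (Btilde a1 a2 a3 ii2).
Proof.
have G a : a \notin [:: 0; 1; -1] -> [/\ a != 0, 1 + a != 0 & 1 - a != 0].
  rewrite !inE !negb_or => /and3P[-> a_neq1 a_neqN1]; split=> //.
    by rewrite addrC addr_eq0.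
  by rewrite subr_eq0 eq_sym.
have Ha : generic_alpha a1 a2 a3.
  by split; [move: char_neq2; rewrite inE /=| |exact: G|exact: G|exact: G].
have [om om'] := sklB_omega a1 a2 a3.
have ev c N (hc : chain a1 a2 a3 c) : exists e : {lrmorphism sklB a1 a2 a3 -> 'M[k]_N.+1},
    forall j, e (xB a1 a2 a3 j) = chain_mx c N j.
  by exists (evB Ha N hc) => j; exact: evB_gen.
have rel b i : i != o0 ->
    rel_elt a1 a2 a3 b i (fun u v => xB a1 a2 a3 u * xB a1 a2 a3 v) = 0.
  exact: rel_elt_sklB.
exact (@Btwist_prime k a1 a2 a3 ii Ha ii2 (sklB a1 a2 a3) (xB a1 a2 a3)
  (fun g => gammaB (a1 := a1) (a2 := a2) (a3 := a3) g)
  rel om om' (@gammaB_gen k a1 a2 a3) (@sklB_span k a1 a2 a3) ev).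
Qed.
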